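(* Let $\mathcal S$ be a collection of bicolored subdivisions of type $(k,n)$ such that $\{\Gamma_\sigma\}_{\sigma\in\mathcal S}$ is a positroid tiling of $\Delta_{k+1,n}$, let $c\in\{1,\dots,k\}$, and let $i\to j$ be an internal arc of $\mathbf P_n$. Then the number of tiles in the tiling having $x_{[i,j-1]}\ge c$ as a facet inequality equals the number having $x_{[i,j-1]}\le c$ as a facet inequality. Equivalently, $$\#\{\sigma\in\mathcal S: i\to j\text{ facet-defining for }\sigma,\ \mathrm{area}_\sigma(i\to j)=c\}=\#\{\sigma\in\mathcal S: j\to i\text{ facet-defining for }\sigma,\ \mathrm{area}_\sigma(i\to j)=c-1\}.$$
   Context: Notation: $x_S=\sum_{s\in S}x_s$; $[a,b]=\{a,\dots,b\}$ cyclically mod $n$; $\Delta_{k+1,n}=\mathrm{conv}\{e_I:|I|=k+1\}$. Let $\mathbf P_n$ be a convex $n$-gon with vertices $1,\dots,n$ clockwise. A bicolored subdivision $\sigma$ of type $(k,n)$ is a partition of $\mathbf P_n$ into black and white polygons (vertices among those of $\mathbf P_n$, polygons sharing an edge differently colored) such that any triangulation of the black polygons has $k$ triangles. An arc $i\to j$ is compatible with $\sigma$ if the chord $(i,j)$ is an edge of or lies inside a polygon of $\sigma$; its left region is the side of the chord containing vertices $i+1,\dots,j-1$; $\mathrm{area}_\sigma(i\to j)$ counts black triangles in the left region in any triangulation of the black polygons; $i\to j$ is facet-defining if $(i,j)$ is an edge of a black polygon lying to its left, and internal if $(i,j)$ is not an edge of $\mathbf P_n$. The positroid tile is $\Gamma_\sigma=\{x\in\mathbb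 R^n:x_{[n]}=k+1,\ \mathrm{area}(a\to b)\le x_{[a,b-1]}\le\mathrm{area}(a\to b)+1$ for all compatible $a\to b\}$; its facet inequalities are $x_a\ge0$ for each vertex $a$ of a white polygon and $x_{[a,b-1]}\ge\mathrm{area}(a\to b)$ for each facet-defining arc $a\to b$ (together with $x_{[n]}=k+1$). A positroid tiling of $\Delta_{k+1,n}$ is a collection of such tiles with pairwise disjoint interiors whose union is $\Delta_{k+1,n}$. *)

(* Defs.v *)
From mathcomp Require Import all_boot all_order all_algebra.
From mathcomp Require Import boolp classical_sets reals topology normedtype.

Set Implicit Arguments.
Unset Strict Implicit.
Unset Printing Implicit Defensive.

Import Order.TTheory GRing.Theory Num.Theory.
Import numFieldNormedType.Exports.

(* The vertices of the convex n-gon P_n are the elements of 'I_n, in clockwise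
   order (vertex i + 1 of the usual labelling is i : 'I_n).  A polygon inscribed
   in P_n is identified with its set of vertices, of cardinality at least 3. *)

(* [a, b] = {a, a + 1, ..., b}, indices mod n; for a <> b these are the vertices
   of P_n in the closed left region of the arc a -> b. *)
Definition cyc n (a b : 'I_n) : {set 'I_n} :=
  [set v : 'I_n | (v + n - a) %% n <= (b + n - a) %% n]%SET.

Definition edge n (Q : {set 'I_n}) (a b : 'I_n) : bool :=
  [&& a != b, a \in Q, b \in Q & (Q \subset cyc a b) || (Q \subset cyc b a)].

(* Two inscribed polygons have disjoint interiors iff some chord (a, b) of P_n
   weakly separates them. *)
Definition int_disjoint n (Q Q' : {set 'I_n}) : bool :=
  [exists a, exists b,
     [&& a != b, Q \subset cyc a b & Q' \subset cyc b a]].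

(* PP is a partition of the polygon P into polygons on the vertices of P: the
   pieces have disjoint interiors and cover P.  The part of P left uncovered by
   interior-disjoint inscribed polygons is itself cut out by noncrossing chords,
   hence a union of inscribed triangles; so PP covers P iff no inscribed
   triangle has its interior disjoint from every piece. *)
Definition subdivision n (P : {set 'I_n}) (PP : {set {set 'I_n}}) : bool :=
  [&& [forall Q in PP, (2 < #|Q|) && (Q \subset P)],
      [forall Q in PP, forall Q' in PP, (Q != Q') ==> int_disjoint Q Q'] &
      [forall t : {set 'I_n}, (#|t| == 3) && (t \subset P) ==>
         [exists Q in PP, ~~ int_disjoint t Q]]].

(* TT is the set of triangles obtained by triangulating every polygon of BB. *)
Definition triangulation n (BB TT : {set {set 'I_n}}) : bool :=
  [&& [forall t in TT, (#|t| == 3) && [exists Q in BB, t \subset Q]] &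
      [forall Q in BB, subdivision Q [set t in TT | t \subset Q]%SET]].

(* Candidate bicolored subdivisions: (black polygons, white polygons). *)
Definition bicolored n : Type := ({set {set 'I_n}} * {set {set 'I_n}})%type.

Definition black n (s : bicolored n) : {set {set 'I_n}} := s.1.
Definition white n (s : bicolored n) : {set {set 'I_n}} := s.2.
Definition pieces n (s : bicolored n) : {set {set 'I_n}} :=
  black s :|: white s.

Definition bicolored_subdivision n (k : nat) (s : bicolored n) : Prop :=
  [/\ subdivision [set: 'I_n] (pieces s),
      [disjoint black s & white s],
      (forall Q Q', Q \in pieces s -> Q' \in pieces s -> Q != Q' ->
         forall a b, edge Q a b -> edge Q' a b ->
         (Q \in black s) != (Q' \in black s)) &
      (forall TT, triangulation (black s) TT -> #|TT| = k)].

(* The vertices of P_n lying on an inscribed polygon are the vertices of that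
   polygon, so a chord is an edge of Q or lies inside Q iff both its ends are
   vertices of Q. *)
Definition compatible n (s : bicolored n) (a b : 'I_n) : bool :=
  (a != b) && [exists Q in pieces s, (a \in Q) && (b \in Q)].

Definition facet_defining n (s : bicolored n) (a b : 'I_n) : bool :=
  [exists Q in black s, edge Q a b && (Q \subset cyc a b)].

Definition internal n (a b : 'I_n) : bool :=
  (a != b) && ~~ edge [set: 'I_n] a b.

(* The count is taken in an arbitrary triangulation of the black polygons none
   of whose triangles is cut by the chord (a, b); it does not depend on the
   choice.  Only meaningful when a -> b is compatible with s. *)
Definition area n (s : bicolored n) (a b : 'I_n) : nat :=
  if [pick TT | triangulation (black s) TT &&
        [forall t in TT, (t \subset cyc a b) || (t \subset cyc b a)]] is Some TT
  then #|[set t in TT | t \subset cyc a b]%SET| else 0.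

Local Open Scope ring_scope.
Local Open Scope classical_set_scope.

Definition xsum (R : realType) n (A : {set 'I_n}) (x : 'rV[R]_n) : R :=
  \sum_(v in A) x ord0 v.

(* x_{[a, b - 1]} *)
Definition xarc (R : realType) n (a b : 'I_n) (x : 'rV[R]_n) : R :=
  xsum (cyc a (ord_pred b)) x.

Definition hyperplane (R : realType) n (k : nat) : set 'rV[R]_n :=
  [set x | xsum [set: 'I_n]%SET x = k.+1%:R].

Definition tile (R : realType) n (k : nat) (s : bicolored n) : set 'rV[R]_n :=
  [set x | hyperplane k x /\
     forall a b, compatible s a b ->
       (area s a b)%:R <= xarc a b x <= (area s a b)%:R + 1].

(* The facet inequalities of a tile are considered modulo x_{[n]} = k + 1, so an
   inequality is identified with the half of this hyperplane where it holds; for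
   instance x_{[a, b - 1]} >= m and x_{[b, a - 1]} <= k + 1 - m coincide. *)
Definition facet_inequality (R : realType) n (k : nat) (s : bicolored n)
    (H : set 'rV[R]_n) : Prop :=
  (exists Q a, [/\ Q \in white s, a \in Q &
     H = hyperplane k `&` [set x | 0 <= x ord0 a]]) \/
  (exists a b, facet_defining s a b /\
     H = hyperplane k `&` [set x | (area s a b)%:R <= xarc a b x]).

Definition indicator_vector (R : realType) n (I : {set 'I_n}) : 'rV[R]_n :=
  \row_v (v \in I)%:R.

(* Delta_{m, n} = conv {e_I : |I| = m} *)
Definition hypersimplex (R : realType) n (m : nat) : set 'rV[R]_n :=
  [set x | exists w : {set 'I_n} -> R,
     [/\ forall I, 0 <= w I,
         \sum_(I : {set 'I_n} | #|I| == m) w I = 1 &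
         x = \sum_(I : {set 'I_n} | #|I| == m) w I *: indicator_vector R I]].

(* Tiles and hypersimplices are full-dimensional in the hyperplane
   x_{[n]} = k + 1, and interiors are taken relative to it. *)
Definition rel_interior (R : realType) n (k : nat) (A : set 'rV[R]_n) :
    set 'rV[R]_n :=
  [set x | hyperplane k x /\ \forall y \near within (hyperplane k) (nbhs x), A y].

Definition positroid_tiling (R : realType) n (k : nat)
    (S : {set bicolored n}) : Prop :=
  [/\ forall s, s \in S -> bicolored_subdivision k s,
      forall s t, s \in S -> t \in S -> s != t ->
        rel_interior k (tile k s) `&` rel_interior k (tile k t)
          = set0 :> set 'rV[R]_n &
      \bigcup_(s in [set s | s \in S]) tile k s
          = hypersimplex k.+1 :> set 'rV[R]_n].

(* Main.v *)
(** Choose distinct reals [phi v] of absolute value less than 1/2 at the vertices;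
    the point with coordinates [phi (v+1) - phi v] modulo 1 lies in the tile of a
    bicolored subdivision iff on every triangle of a white (resp. black) piece the
    values of [phi] have the cyclic order of the vertices (resp. the opposite one).
    If the absolute values increase along the polygon, the orientation of a triangle
    is the sign of [phi] at its middle vertex, and every vertex but the first and
    the last is the middle vertex of exactly one piece: the signs read off the
    colours give exactly one such point in the tile.

    For a chord (i, j), take [phi i] and [phi j] opposite and smaller than all other
    values, with absolute values increasing along each of the two arcs.  By the same
    argument, a tile having (i, j) as a facet contains the point of exactly one sign
    pattern on its side of the wall.  Exchanging [phi i] and [phi j] moves the point
    across the wall [x_[i, j-1] = c] and across no other one, so for each sign pattern
    the two points lie in the same tile or in two tiles having the wall as a facet,
    one on each side.  Hence both kinds of tiles are in bijection with the sign
    patterns that change tile. *)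
Require Import Defs.
From mathcomp Require Import all_boot all_order all_algebra.
From mathcomp Require Import boolp classical_sets reals topology normedtype.
From mathcomp Require Import zify ring lra.

Set Implicit Arguments.
Unset Strict Implicit.
Unset Printing Implicit Defensive.

Import Order.TTheory GRing.Theory Num.Theory.
Import numFieldNormedType.Exports.
(* [classical_sets] shadows the lemmas on finite sets. *)
Import boot.fintype boot.finset.

(** * Cyclic order *)

(** Clockwise distance from [o] to [v]. Cutting the circle at [o] turns statements on cyclic order
    into linear arithmetic, which [lia] decides. *)
Definition rank n (o v : 'I_n) : nat := (v + n - o) %% n.

Definition btw n (a v b : 'I_n) : bool := 0 < rank a v < rank a b.

Lemma rankP n (o v : 'I_n) :
  (o <= v) && (rank o v == v - o) || (v < o) && (rank o v == v + n - o).
Proof.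
rewrite /rank; have := ltn_ord o; have := ltn_ord v => hv ho.
case: (leqP o v) => hov /=.
  by rewrite addnC -addnBA // modnDl modn_small ?eqxx //; lia.
by rewrite modn_small ?eqxx //; lia.
Qed.

Lemma rank_inj n (o : 'I_n) : injective (rank o).
Proof.
move=> u v h; apply: val_inj => /=; move: (rankP o u) (rankP o v); rewrite h.
by have := ltn_ord u; have := ltn_ord v; have := ltn_ord o; lia.
Qed.

Lemma rank_neq n (o u v : 'I_n) : u != v -> rank o u != rank o v.
Proof. by apply: contraNneq => /rank_inj ->. Qed.

Lemma rankoo n (o : 'I_n) : rank o o = 0.
Proof. by have := rankP o o; lia. Qed.

Lemma rank_gt0 n (o v : 'I_n) : (0 < rank o v) = (v != o).
Proof. by rewrite lt0n -(rankoo o) (inj_eq (@rank_inj n o)). Qed.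

Lemma rank_lt n (o v : 'I_n) : rank o v < n.
Proof. by have := rankP o v; have := ltn_ord v; have := ltn_ord o; lia. Qed.

(** Change of base point: distances from [a] are differences of distances from [o], corrected by [n]
    when the way from [a] to [v] passes [o]. *)
Lemma rank_shift n (o a v : 'I_n) :
  (rank o a <= rank o v) && (rank a v == rank o v - rank o a)
  || (rank o v < rank o a) && (rank a v == rank o v + n - rank o a).
Proof.
have := ltn_ord a; have := ltn_ord v; have := ltn_ord o => ho hv ha.
by case/orP: (rankP o a) => /andP[h1 /eqP->];
   case/orP: (rankP o v) => /andP[h2 /eqP->];
   case/orP: (rankP a v) => /andP[h3 /eqP->]; lia.
Qed.

Lemma in_cyc n (o a b v : 'I_n) : (v \in cyc a b) =
  (rank o a <= rank o b) && (rank o a <= rank o v <= rank o b)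
  || (rank o b < rank o a) && ((rank o a <= rank o v) || (rank o v <= rank o b)).
Proof.
rewrite inE -!/(rank _ _).
have := rank_lt o a; have := rank_lt o v; have := rank_lt o b.
by case/orP: (rank_shift o a v) => /andP[h2 /eqP->];
   case/orP: (rank_shift o a b) => /andP[h3 /eqP->]; lia.
Qed.

Lemma in_cyc_le n (o a b v : 'I_n) : rank o a <= rank o b ->
  (v \in cyc a b) = (rank o a <= rank o v <= rank o b).
Proof. by move=> h; rewrite (in_cyc o) h ltnNge h /= orbF. Qed.

Lemma in_cyc_gt n (o a b v : 'I_n) : rank o b < rank o a ->
  (v \in cyc a b) = (rank o a <= rank o v) || (rank o v <= rank o b).
Proof. by move=> h; rewrite (in_cyc o) h leqNgt h. Qed.

Lemma btwE n (o a v b : 'I_n) : btw a v b =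
  [|| rank o a < rank o v < rank o b, rank o v < rank o b < rank o a
    | rank o b < rank o a < rank o v].
Proof.
rewrite /btw.
have := rank_lt o a; have := rank_lt o v; have := rank_lt o b.
by case/orP: (rank_shift o a v) => /andP[h2 /eqP->];
   case/orP: (rank_shift o a b) => /andP[h3 /eqP->]; lia.
Qed.

Lemma btw_rot n (a v b : 'I_n) : btw a v b = btw v b a.
Proof. by rewrite !(btwE a); lia. Qed.

Lemma btwW n (a v b : 'I_n) : btw a v b -> [/\ v != a, v != b & a != b].
Proof.
by move=> h; split; apply/eqP => e; move: h; rewrite (btwE a) e; lia.
Qed.

Lemma btwT n (a v b : 'I_n) : a != b -> v != a -> v != b ->
  btw a v b || btw b v a.
Proof.
move=> /(rank_neq a) h1 /(rank_neq a) h2 /(rank_neq a) h3.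
by rewrite !(btwE a); lia.
Qed.

Lemma in_cyc_btw n (a b v : 'I_n) :
  (v \in cyc a b) = [|| v == a, v == b | btw a v b].
Proof.
case: (eqVneq v a) => [->|nva]; first by rewrite (in_cyc a); lia.
case: (eqVneq v b) => [->|nvb] /=; first by rewrite (in_cyc a) rankoo; lia.
rewrite (in_cyc a) (btwE a) rankoo.
by move: (rank_neq a nva) (rank_neq a nvb); rewrite rankoo; lia.
Qed.

(** * Interior-disjoint polygons *)

Lemma int_disjointP n (Q Q' : {set 'I_n}) :
  reflect (exists a b, [/\ a != b, {in Q, forall v, v \in cyc a b}
                         & {in Q', forall v, v \in cyc b a}])
          (int_disjoint Q Q').
Proof.
apply: (iffP existsP) => [[a /existsP[b /and3P[nab /subsetP ha /subsetP hb]]]|].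
  by exists a, b.
move=> [a [b [nab ha hb]]]; exists a; apply/existsP; exists b.
by rewrite nab /=; apply/andP; split; apply/subsetP.
Qed.

Lemma int_disjointC n (Q Q' : {set 'I_n}) : int_disjoint Q Q' -> int_disjoint Q' Q.
Proof.
move=> /int_disjointP[a [b [nab h h']]]; apply/int_disjointP; exists b, a.
by rewrite eq_sym.
Qed.

(** The chord [(a, b)] stays on the side of the separating chord that holds [Q], so [Q'] lies
    entirely on the side of [(a, b)] facing that separating chord. *)
Lemma int_disjoint_side n (Q Q' : {set 'I_n}) a b :
  int_disjoint Q Q' -> a \in Q -> b \in Q -> a != b ->
  (Q' \subset cyc a b) || (Q' \subset cyc b a).
Proof.
move=> /int_disjointP[s [t [nst h h']]] /h + /h + /(rank_neq s) nab.
rewrite !(in_cyc s) !rankoo => ha hb; apply/orP.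
case: (leqP (rank s a) (rank s b)) => hab; [right|left];
  by apply/subsetP => v /h'; rewrite !(in_cyc s) rankoo; lia.
Qed.

Lemma int_disjoint_side3 n (Q Q' : {set 'I_n}) a v b :
  int_disjoint Q Q' -> a \in Q -> v \in Q -> b \in Q -> btw a v b ->
  [|| Q' \subset cyc a v, Q' \subset cyc v b | Q' \subset cyc b a].
Proof.
move=> /int_disjointP[s [t [nst h h']]] /h + /h + /h +.
rewrite !(in_cyc s) !rankoo (btwE s) => ha hv hb hab.
have [h0|[h0|h0]] : rank s a < rank s v < rank s b \/
   (rank s v < rank s b < rank s a \/ rank s b < rank s a < rank s v) by lia.
all: apply/or3P.
1: constructor 3. 2: constructor 1. 3: constructor 2.
all: by apply/subsetP => u /h'; rewrite !(in_cyc s) rankoo; lia.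
Qed.

(** * Middle vertices *)

(** These are the vertices of [Q] other than the first and the last one clockwise from [o]. A
    triangle has exactly one, which is used to count triangles by vertices. *)
Definition mid n (o : 'I_n) (Q : {set 'I_n}) : {set 'I_n} :=
  [set v in Q | [exists x in Q, rank o x < rank o v]
             && [exists y in Q, rank o v < rank o y]].

Lemma midP n (o : 'I_n) (Q : {set 'I_n}) v :
  reflect (exists x y, [/\ v \in Q, x \in Q, y \in Q & rank o x < rank o v < rank o y])
          (v \in mid o Q).
Proof.
rewrite inE; apply: (iffP and3P).
  move=> [vQ /existsP[x /andP[xQ hx]] /existsP[y /andP[yQ hy]]].
  by exists x, y; rewrite hx.
move=> [x [y [vQ xQ yQ /andP[hx hy]]]]; split=> //; apply/existsP.
  by exists x; rewrite xQ.
by exists y; rewrite yQ.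
Qed.

Lemma mid_subset n (o : 'I_n) (Q Q' : {set 'I_n}) : Q \subset Q' -> mid o Q \subset mid o Q'.
Proof.
move=> /subsetP h; apply/subsetP => v /midP[x [y [hv hx hy hr]]].
by apply/midP; exists x, y; split; rewrite ?h.
Qed.

Lemma card_mid n (o : 'I_n) (Q : {set 'I_n}) : #|mid o Q| = #|Q| - 2.
Proof.
case: (posnP #|Q|) => [/eqP|].
  rewrite cards_eq0 => /eqP ->; rewrite cards0; apply/eqP; rewrite cards_eq0.
  by apply/eqP/setP => v; rewrite !inE.
rewrite card_gt0 => /set0Pn[q hq].
pose m := [arg min_(x < q in Q) rank o x].
pose M := [arg max_(x > q in Q) rank o x].
have [mQ hm] : m \in Q /\ forall x, x \in Q -> rank o m <= rank o x.
  by rewrite /m; case: arg_minnP.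
have [MQ hM] : M \in Q /\ forall x, x \in Q -> rank o x <= rank o M.
  by rewrite /M; case: arg_maxnP.
have -> : mid o Q = (Q :\ m) :\ M.
  apply/setP => v; apply/midP/idP.
    move=> [x [y [vQ xQ yQ h]]]; rewrite !inE vQ andbT.
    by apply/andP; split; apply/eqP => e; move: (hm _ xQ) (hM _ yQ); rewrite -e; lia.
  rewrite !inE => /and3P[vM vm vQ]; exists m, M; split=> //.
  move: (rank_neq o vM) (rank_neq o vm) (hm _ vQ) (hM _ vQ); lia.
have h1 := cardsD1 M (Q :\ m); have h2 := cardsD1 m Q.
rewrite !inE MQ andbT in h1; rewrite mQ in h2.
(* First and last vertex coincide only for a singleton; truncated subtraction then gives 0, as
   required. *)
case: (eqVneq M m) h1 => [e|_] h1; last by move: h1 h2; rewrite /=; lia.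
suff : #|Q :\ m| = 0 by lia.
apply/eqP; rewrite cards_eq0; apply/eqP/setP => v; rewrite !inE.
apply/negP => /andP[/(rank_neq o) nv vQ].
by move: (hm _ vQ) (hM _ vQ); rewrite e; lia.
Qed.

(** The segment from [v] to the gap just before [o] enters the interior of every polygon that has
    [v] as a middle vertex, so two such polygons overlap near [v]. *)
Lemma mid_unique n (o : 'I_n) (Q Q' : {set 'I_n}) v :
  v \in mid o Q -> v \in mid o Q' -> ~~ int_disjoint Q Q'.
Proof.
move=> /midP[x [y [vQ xQ yQ hr]]] /midP[x' [y' [vQ' xQ' yQ' hr']]].
apply/negP => /int_disjointP[s [t [/(rank_neq o) nst h h']]].
move: (h _ vQ) (h _ xQ) (h _ yQ) (h' _ vQ') (h' _ xQ') (h' _ yQ').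
by rewrite !(in_cyc o); lia.
Qed.

Lemma subdivisionP n (P : {set 'I_n}) (PP : {set {set 'I_n}}) :
  subdivision P PP ->
  [/\ forall Q, Q \in PP -> 2 < #|Q| /\ Q \subset P,
      forall Q Q', Q \in PP -> Q' \in PP -> Q != Q' -> int_disjoint Q Q' &
      forall t : {set 'I_n}, #|t| = 3 -> t \subset P ->
        exists2 Q, Q \in PP & ~~ int_disjoint t Q].
Proof.
case/and3P => h1 h2 h3; split.
- by move=> Q hQ; move/forallP/(_ Q): h1; rewrite hQ => /andP[].
- move=> Q Q' hQ hQ' hn; move/forallP/(_ Q): h2; rewrite hQ /=.
  by move/forallP/(_ Q'); rewrite hQ' hn.
- move=> t ht hP; move/forallP/(_ t): h3; rewrite ht eqxx hP /=.
  by move/existsP => [Q /andP[hQ hd]]; exists Q.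
Qed.

Lemma mid_mem n (o : 'I_n) (Q : {set 'I_n}) x v y : v \in Q -> x \in Q -> y \in Q ->
  rank o x < rank o v < rank o y -> v \in mid o Q.
Proof. by move=> hv hx hy h; apply/midP; exists x, y. Qed.

(* Applied to both orientations [d] of the rank order at a vertex [v] that is a middle
   vertex of no piece, this gives a triangle {a, v, b} that no piece covers. *)
Lemma leftmost_neighbour n (o : 'I_n) (P : {set 'I_n}) (PP : {set {set 'I_n}})
    (v l : 'I_n) (d : bool) (K : 'I_n -> nat) :
  K =1 (fun x => if d then rank o x else n - rank o x) ->
  subdivision P PP -> (forall Q, Q \in PP -> v \notin mid o Q) ->
  l \in P -> K l < K v ->
  exists a, [/\ a \in P, K a < K v,
    forall Q, Q \in PP -> (forall q, q \in Q -> K q <= K v) ->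
      (forall q, q \in Q -> K a <= K q) \/ (forall q, q \in Q -> K q <= K a) &
    forall Q q q', Q \in PP -> q \in Q -> q' \in Q -> K q < K v < K q' ->
      K q <= K a].
Proof.
move=> KE /subdivisionP[h1 h2 _] hN lP hl.
have hlt x : rank o x < n by apply: rank_lt.
(* [x] is good if it lies on a piece whose last vertex in the order [K] is [v]. The good vertex
   farthest from [v] is taken; if there is none, the vertex of [P] closest before [v] serves. *)
pose good x := [exists Q in PP, [&& x \in Q, v \in Q & [forall q in Q, K q <= K v]]].
case: (pickP good) => [x0 hx0|hno].
  case: (arg_minnP K hx0) => a /existsP[Q0 /andP[hQ0 /and3P[aQ vQ /forallP hv]]] hmin.
  have {}hv q : q \in Q0 -> K q <= K v by move=> hq; have := hv q; rewrite hq.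
  have gd Q q : Q \in PP -> q \in Q -> v \in Q -> (forall q, q \in Q -> K q <= K v) ->
      K a <= K q.
    move=> hQ hq hvQ hle; apply: hmin; apply/existsP; exists Q.
    by rewrite hQ hq hvQ /=; apply/forallP => z; apply/implyP/hle.
  have hav : K a < K v.
    have [c3 _] := h1 _ hQ0.
    have : 0 < #|Q0 :\ v| by move: c3; rewrite (cardsD1 v) vQ add1n ltnS; apply: leq_trans.
    rewrite card_gt0 => /set0Pn[z]; rewrite !inE => /andP[/(rank_neq o) zv zQ].
    have := gd _ _ hQ0 zQ vQ hv; have := hv _ zQ.
    by have := hlt z; have := hlt v; rewrite !KE; case: (d); lia.
  have nav : a != v by apply/eqP => e; rewrite e ltnn in hav.
  exists a; split=> //.
  - by have [_ /subsetP] := h1 _ hQ0; apply.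
  - move=> Q hQ hle.
    case: (boolP (v \in Q)) => vQ'; first by left=> q hq; apply: gd hq vQ' hle.
    have nQ : Q0 != Q by apply: contraNneq vQ' => <-.
    have sd := int_disjoint_side (h2 _ _ hQ0 hQ nQ) aQ vQ nav.
    have nqv q : q \in Q -> rank o q != rank o v.
      by move=> hq; apply: rank_neq; apply: contraNneq vQ' => <-.
    case: d KE => KE; rewrite !KE in hav.
      have ha := ltnW hav.
      case/orP: sd => /subsetP sd; [left|right] => q hq;
        move: (sd _ hq) (nqv _ hq) (hle _ hq); rewrite !KE.
        by rewrite (in_cyc_le _ ha) => /andP[].
      by rewrite (in_cyc_gt _ hav); clear; lia.
    have {}hav : rank o v < rank o a by move: hav (hlt a) (hlt v); clear; lia.
    case/orP: sd => /subsetP sd; [right|left] => q hq;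
      move: (sd _ hq) (nqv _ hq) (hle _ hq) (hlt q) (hlt v) (hlt a); rewrite !KE.
      by rewrite (in_cyc_gt _ hav); clear; lia.
    by rewrite (in_cyc_le _ (ltnW hav)); clear; lia.
  - move=> Q q q' hQ hq hq' hqq.
    have nQ : Q != Q0 by apply/eqP => e; rewrite e in hq'; move: (hv _ hq') hqq; clear; lia.
    have nqq : q != q' by apply/eqP => e; move: hqq; rewrite e; clear; lia.
    have sd := int_disjoint_side (h2 _ _ hQ hQ0 nQ) hq hq' nqq.
    case: d KE => KE; rewrite !KE in hqq hav *.
      have hlt' : rank o q < rank o q' by move: hqq; clear; lia.
      case/orP: sd => /subsetP sd; move: (sd _ aQ) (sd _ vQ) hqq hav.
        by rewrite !(in_cyc_le _ (ltnW hlt')); clear; lia.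
      by rewrite !(in_cyc_gt _ hlt'); clear; lia.
    have hlt' : rank o q' < rank o q by move: hqq (hlt q) (hlt q'); clear; lia.
    case/orP: sd => /subsetP sd; move: (sd _ aQ) (sd _ vQ) hqq hav (hlt q) (hlt v) (hlt a) (hlt q').
      by rewrite !(in_cyc_gt _ hlt'); clear; lia.
    by rewrite !(in_cyc_le _ (ltnW hlt')); clear; lia.
have hPl : (l \in P) && (K l < K v) by rewrite lP.
case: (@arg_maxnP _ l [pred x | (x \in P) && (K x < K v)] K hPl) => a /= /andP[aP hav] hmax.
exists a; split=> // [Q hQ hle|Q q q' hQ hq hq' /andP[hqv _]].
  right=> q hq; have [_ /subsetP sQ] := h1 _ hQ.
  apply: hmax; rewrite sQ //= ltn_neqAle hle // andbT.
  have nqv : q != v.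
    apply: contraFneq (hno v) => e; rewrite /good; apply/existsP; exists Q.
    rewrite hQ -{1}e hq -{1}e hq /=; apply/forallP => z; apply/implyP; exact: hle.
  by have := rank_neq o nqv; have := hlt q; have := hlt v; rewrite !KE; case: (d); lia.
by have [_ /subsetP sQ] := h1 _ hQ; apply: hmax; rewrite sQ.
Qed.

Lemma cards3 (T : finType) (x y z : T) :
  x != y -> y != z -> x != z -> #|[set x; y; z]| = 3.
Proof.
by move=> xy yz xz; rewrite -setUA cardsU1 !inE cards2 negb_or xy xz yz.
Qed.

(** Otherwise the neighbour lemma, applied before and after [v], yields a triangle [{a, v, b}]
    disjoint from all pieces, against covering. Together with [mid_unique], the middle vertices of
    the pieces partition those of [P]. *)
Lemma mid_exists n (o : 'I_n) (P : {set 'I_n}) (PP : {set {set 'I_n}}) v :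
  subdivision P PP -> v \in mid o P -> exists2 Q, Q \in PP & v \in mid o Q.
Proof.
move=> sd /midP[l [u [vP lP uP /andP[hl hu]]]].
case: (pickP [pred Q in PP | v \in mid o Q]) => [Q /andP[]|hno]; first by exists Q.
have hN Q : Q \in PP -> v \notin mid o Q.
  by move=> hQ; have := hno Q; rewrite /= hQ /= => ->.
have hlt x : rank o x < n by apply: rank_lt.
have [a [aP hav aL aC]] := leftmost_neighbour (K := rank o) (d := true) (fun=> erefl) sd hN lP hl.
have hu' : n - rank o u < n - rank o v by rewrite ltn_sub2l.
have [b [bP hbv bL bC]] :=
  leftmost_neighbour (K := fun x => n - rank o x) (d := false) (fun=> erefl) sd hN uP hu'.
have [_ _ /(_ [set a; v; b])] := subdivisionP sd.
have nav : a != v by apply/eqP => e; move: hav; rewrite e ltnn.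
have nvb : v != b by apply/eqP => e; move: hbv; rewrite e ltnn.
have nab : a != b by apply/eqP => e; move: hav hbv; rewrite e; clear; lia.
case.
- exact: cards3.
- by apply/subsetP => x; rewrite !inE => /orP[/orP[]|] /eqP->.
move=> Q hQ /negP; case; apply/int_disjointP.
have sep x y : x != y -> a \in cyc x y -> v \in cyc x y -> b \in cyc x y ->
   (forall q, q \in Q -> q \in cyc y x) ->
   exists x y, [/\ x != y, {in [set a; v; b], forall v, v \in cyc x y}
                         & {in Q, forall v, v \in cyc y x}].
  move=> nxy ax vx bx hq; exists x, y; split=> //.
  by move=> z; rewrite !in_setU !in_set1 => /orP[/orP[]|] /eqP->.
have {hu'}hbv : rank o v < rank o b by move: hbv (hlt b) (hlt v); clear; lia.
have hab : rank o a < rank o b := ltn_trans hav hbv.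
have hav' := ltnW hav; have hbv' := ltnW hbv; have hab' := ltnW hab.
(* A piece with vertices on both sides of [v] is separated from the triangle by [(a, b)]. A piece on
   one side is separated by the side of the triangle from [v] to [b] or to [a], or again by
   [(a, b)]. *)
case: (pickP [pred q in Q | rank o v < rank o q]) => [r /andP[rQ hr]|hno1].
  case: (pickP [pred q in Q | rank o q < rank o v]) => [q /andP[qQ hq]|hno2].
    have vQ : v \notin Q.
      by apply: contra (hN _ hQ) => vQ; apply: (mid_mem vQ qQ rQ); rewrite hq.
    apply: (sep a b) => //; rewrite ?(in_cyc_le _ hab') ?leqnn ?hav' ?hbv' ?hab' //=.
    move=> z zQ; have nz : z != v by apply: contraNneq vQ => <-.
    rewrite (in_cyc_gt _ hab); move: (rank_neq o nz) (aC Q z r hQ zQ rQ)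
      (bC Q z q hQ zQ qQ) (hlt z) (hlt b) (hlt q) (hlt v) hr hq.
    by clear; lia.
  have hge q : q \in Q -> rank o v <= rank o q.
    by move=> qQ; have := hno2 q; rewrite /= qQ /= ltnNge => /negbFE.
  have hge' q : q \in Q -> n - rank o q <= n - rank o v.
    by move=> qQ; rewrite leq_sub2l // hge.
  case: (bL Q hQ hge') => h.
    have hbv2 : b != v by rewrite eq_sym.
    apply: (sep b v) => //; rewrite ?(in_cyc_gt _ hbv) ?leqnn ?orbT ?hav' ?orbT //.
    move=> q qQ; rewrite (in_cyc_le _ (ltnW hbv)) hge //=.
    by move: (h _ qQ) (hlt q) (hlt b); clear; lia.
  apply: (sep a b) => //; rewrite ?(in_cyc_le _ hab') ?leqnn ?hav' ?hbv' ?hab' //=.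
  move=> q qQ; rewrite (in_cyc_gt _ hab).
  by move: (h _ qQ) (hlt q) (hlt b); clear; lia.
have hle q : q \in Q -> rank o q <= rank o v.
  by move=> qQ; have := hno1 q; rewrite /= qQ /= ltnNge => /negbFE.
case: (aL Q hQ hle) => h.
  have hva : v != a by rewrite eq_sym.
  by apply: (sep v a) => //; rewrite ?(in_cyc_gt _ hav) ?leqnn ?hbv' ?orbT //;
    move=> q qQ; rewrite (in_cyc_le _ hav') hle // h.
apply: (sep a b) => //; rewrite ?(in_cyc_le _ hab') ?leqnn ?hav' ?hbv' ?hab' //=.
by move=> q qQ; rewrite (in_cyc_gt _ hab) h ?orbT.
Qed.

(** The piece with [a] as middle vertex in the order from [b] reaches a vertex left of the chord. If
    it is not the piece known to contain the chord, its vertex before [a] must be [b], since the two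
    pieces do not overlap. This provides the triangle for inductions across a chord. *)
Lemma compatible_btw n (s : bicolored n) a b v :
  subdivision [set: 'I_n] (pieces s) -> compatible s a b -> btw a v b ->
  exists Q w, [/\ Q \in pieces s, a \in Q, b \in Q, w \in Q & btw a w b].
Proof.
move=> sd /andP[nab /existsP[Q0 /and3P[hQ0 aQ0 bQ0]]] hv.
have [Q hQ /midP[x [y [aQ xQ yQ hr]]]] : exists2 Q, Q \in pieces s & a \in mid b Q.
  apply: mid_exists sd _; apply: (@mid_mem _ _ _ b _ v); rewrite ?inE //.
  by move: hv; rewrite (btwE b) rankoo; clear; lia.
have hay : btw a y b by rewrite (btwE b) rankoo; move: hr; clear; lia.
case: (eqVneq Q Q0) => [e|nQ]; first by exists Q, y; split=> //; rewrite e.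
have [_ /(_ _ _ hQ hQ0 nQ) /int_disjointP[s1 [t1 [/(rank_neq b) nst h h']]] _] := subdivisionP sd.
have xb : x = b.
  apply: (@rank_inj _ b); move: (h _ aQ) (h _ xQ) (h _ yQ) (h' _ aQ0) (h' _ bQ0).
  by move: hr nst; rewrite !(in_cyc b) !rankoo; clear; lia.
by exists Q, y; split=> //; rewrite -xb.
Qed.

(** * The area of an arc *)

Lemma card_double_count (T U : finType) (A : {set T}) (B : {set U}) (e : T -> U -> bool) :
  (forall x, x \in A -> exists2 y, y \in B & e x y) ->
  (forall x y y', x \in A -> y \in B -> y' \in B -> e x y -> e x y' -> y = y') ->
  #|A| = \sum_(y in B) #|[set x in A | e x y]|.
Proof.
move=> ex un.
under eq_bigr do rewrite -sum1_card.
under eq_bigr do under eq_bigl do rewrite inE.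
rewrite -sum1_card (exchange_big_dep (mem A)) /=; last by move=> y x _ /andP[].
apply: eq_bigr => x xA; have [y yB exy] := ex _ xA.
rewrite (bigD1 y) /=; last by rewrite yB xA.
rewrite big1 // => y' /andP[/andP[y'B /andP[_ e']] /eqP ne].
by case: ne; apply: un xA y'B yB e' exy.
Qed.

Lemma card_mid_triangle n (o : 'I_n) (t : {set 'I_n}) : #|t| = 3 ->
  exists v, mid o t = [set v].
Proof. by move=> h; apply/cards1P; rewrite card_mid h. Qed.

(** Each triangle on the left is charged to its middle vertex in the order from [a]; the vertices
    charged are exactly the middle vertices of the left part of [Q]. *)
Lemma card_triangles_left n (a b : 'I_n) (Q : {set 'I_n}) (TT : {set {set 'I_n}}) :
  subdivision Q TT -> (forall t, t \in TT -> #|t| = 3) ->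
  (forall t, t \in TT -> (t \subset cyc a b) || (t \subset cyc b a)) ->
  #|[set t in TT | t \subset cyc a b]| = #|Q :&: cyc a b| - 2.
Proof.
move=> sd h3 cut; rewrite -(card_mid a).
have [h1 h2 _] := subdivisionP sd.
rewrite (@card_double_count _ _ _ [set t in TT | t \subset cyc a b]
           (fun v t => v \in mid a t)).
- rewrite -sum1_card; apply: eq_bigr => t; rewrite inE => /andP[tT tc].
  have [v hv] := card_mid_triangle a (h3 _ tT).
  rewrite hv; apply/eqP; rewrite eq_sym; apply/cards1P; exists v.
  apply/setP => x; rewrite in_set !in_set1.
  case: (eqVneq x v) => [->|]; rewrite ?andbF // andbT.
  have : v \in mid a t by rewrite hv in_set1.
  have [_ tQ] := h1 _ tT.
  have : mid a t \subset mid a (Q :&: cyc a b).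
    by apply: mid_subset; rewrite subsetI tQ.
  by move=> /subsetP h /h.
- move=> v hv; have vQ : v \in mid a Q.
    by have /subsetP := mid_subset a (subsetIl Q (cyc a b)); apply.
  have [t tT vt] := mid_exists sd vQ; exists t => //; rewrite inE tT /=.
  case/orP: (cut _ tT) => // tba.
  have vab : btw a v b.
    case/midP: hv => x [y [_ _]]; rewrite inE => /andP[_].
    by rewrite (in_cyc a) (btwE a) rankoo; clear; lia.
  have : v \in cyc b a by apply: (subsetP tba); case/midP: vt => ? [? []].
  by move: vab; rewrite (in_cyc a) (btwE a) rankoo; clear; lia.
- move=> v t t' _; rewrite 2!in_set => /andP[tT _] /andP[tT' _] m m'.
  apply/eqP/negPn/negP => nt; have := h2 _ _ tT tT' nt.
  by apply/negP; apply: mid_unique m m'.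
Qed.

Lemma common_triangle n (Q Q' t : {set 'I_n}) : int_disjoint Q Q' -> #|t| = 3 ->
  t \subset Q -> t \subset Q' -> False.
Proof.
move=> d ht /subsetP tQ /subsetP tQ'.
case: (pickP (mem t)) => [o _|]; last by move=> h; move: ht; rewrite eq_card0.
have [v] := card_mid_triangle o ht; move/setP/(_ v); rewrite in_set1 eqxx => m.
have m1 : v \in mid o Q by apply: (subsetP (mid_subset o _) _ m); apply/subsetP.
have m2 : v \in mid o Q' by apply: (subsetP (mid_subset o _) _ m); apply/subsetP.
by move: (mid_unique m1 m2); rewrite d.
Qed.

Lemma triangulationP n (BB TT : {set {set 'I_n}}) : triangulation BB TT <->
  (forall t, t \in TT -> #|t| = 3 /\ exists2 Q, Q \in BB & t \subset Q) /\
  (forall Q, Q \in BB -> subdivision Q [set t in TT | t \subset Q]).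
Proof.
split=> [/andP[/forallP h1 /forallP h2]|[h1 h2]].
  split=> [t tT|Q QB].
    move: (h1 t); rewrite tT => /andP[/eqP-> /existsP[Q /andP[]]].
    by split=> //; exists Q.
  by move: (h2 Q); rewrite QB.
apply/andP; split; apply/forallP => t; apply/implyP; last exact: h2.
move=> /h1[-> [Q QB tQ]]; rewrite eqxx; apply/existsP; exists Q.
by rewrite QB.
Qed.

(** The area of an arc without a chosen triangulation: an m-gon has m - 2 triangles, and truncated
    subtraction discards polygons with at most two vertices in the left region. *)
Definition left_area n (BB : {set {set 'I_n}}) (a b : 'I_n) : nat :=
  \sum_(Q in BB) (#|Q :&: cyc a b| - 2).

Lemma card_triangulation_left n (BB TT : {set {set 'I_n}}) (a b : 'I_n) :
  (forall Q Q', Q \in BB -> Q' \in BB -> Q != Q' -> int_disjoint Q Q') ->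
  triangulation BB TT ->
  (forall t, t \in TT -> (t \subset cyc a b) || (t \subset cyc b a)) ->
  #|[set t in TT | t \subset cyc a b]| = left_area BB a b.
Proof.
move=> dj /triangulationP[h1 h2] cut.
rewrite (@card_double_count _ _ _ BB (fun (t Q : {set 'I_n}) => t \subset Q)).
- apply: eq_bigr => Q QB; rewrite -(card_triangles_left (h2 _ QB)).
  + by apply: eq_card => t; rewrite !in_set andbAC.
  + by move=> t; rewrite in_set => /andP[/h1[]].
  + by move=> t; rewrite in_set => /andP[/cut].
- by move=> t; rewrite in_set => /andP[/h1[_ ?]].
- move=> t Q Q'; rewrite in_set => /andP[/h1[ht _] _] QB QB' tQ tQ'.
  apply/eqP/negPn/negP => nQ; exact: common_triangle (dj _ _ QB QB' nQ) ht tQ tQ'.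
Qed.

(** The fan triangulation of [Q] from its first vertex clockwise from [o]. The last condition makes
    [x] that vertex and makes [y], [z] consecutive in [Q]; [o] may lie outside [Q]. *)
Definition fan n (o : 'I_n) (Q : {set 'I_n}) : {set {set 'I_n}} :=
  [set t | [exists x, exists y, exists z,
    [&& [&& x \in Q, y \in Q & z \in Q], t == [set x; y; z],
        rank o x < rank o y < rank o z &
        [forall w in Q, (rank o x <= rank o w) &&
           ((rank o w <= rank o y) || (rank o z <= rank o w))]]]].

Lemma fanP n (o : 'I_n) (Q t : {set 'I_n}) : reflect
  (exists x y z, [/\ [/\ x \in Q, y \in Q & z \in Q], t = [set x; y; z],
     rank o x < rank o y < rank o z &
     forall w, w \in Q -> (rank o x <= rank o w) /\
       ((rank o w <= rank o y) || (rank o z <= rank o w))])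
  (t \in fan o Q).
Proof.
rewrite in_set; apply: (iffP existsP).
  move=> [x /existsP[y /existsP[z /and4P[/and3P[xQ yQ zQ] /eqP te r /forallP h]]]].
  by exists x, y, z; split=> // w wQ; move: (h w); rewrite wQ => /andP[].
move=> [x [y [z [[xQ yQ zQ] te r h]]]]; exists x.
apply/existsP; exists y; apply/existsP; exists z.
rewrite xQ yQ zQ te eqxx r /=; apply/forallP => w; apply/implyP => /h[-> ->] //.
Qed.

Lemma fan_triangle n (o : 'I_n) (Q t : {set 'I_n}) : t \in fan o Q ->
  #|t| = 3 /\ t \subset Q.
Proof.
case/fanP => x [y [z [[xQ yQ zQ] -> r h]]]; split.
  by apply: cards3; apply/eqP => e; move: r; rewrite e; clear; lia.
by apply/subsetP => w; rewrite !in_setU !in_set1 => /orP[/orP[]|] /eqP->.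
Qed.

Lemma in_set3 (T : finType) (x y z : T) :
  [/\ x \in [set x; y; z], y \in [set x; y; z] & z \in [set x; y; z]].
Proof. by rewrite !in_setU !in_set1 !eqxx ?orbT. Qed.

Lemma sub_set3 (T : finType) (x y z : T) (P : pred T) : P x -> P y -> P z ->
  {in [set x; y; z], forall v, P v}.
Proof.
by move=> *; move=> w; rewrite !in_setU !in_set1 => /orP[/orP[]|] /eqP->.
Qed.

Lemma fan_disjoint n (o : 'I_n) (Q t t' : {set 'I_n}) : t \in fan o Q ->
  t' \in fan o Q -> t != t' -> int_disjoint t t'.
Proof.
(* Both triangles share the apex of the fan, and their bases follow each other up to exchanging
   them; the side [(x, z)] of the earlier one separates them. *)
wlog: t t' / exists x y z x' y' z', [/\ [/\ x \in Q, y \in Q, z \in Q & t = [set x; y; z]],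
     [/\ x' \in Q, y' \in Q, z' \in Q & t' = [set x'; y'; z']],
     rank o x < rank o y < rank o z, rank o x' < rank o y' < rank o z' &
     [/\ rank o x = rank o x', rank o z <= rank o y' & x = x']] => [H|].
  move=> ft ft' nt.
  have [x [y [z [[xQ yQ zQ] te r h]]]] := fanP _ _ _ ft.
  have [x' [y' [z' [[xQ' yQ' zQ'] te' r' h']]]] := fanP _ _ _ ft'.
  have exx : rank o x = rank o x' by move: (h _ xQ') (h' _ xQ) => [+ _] [+ _]; clear; lia.
  case: (leqP (rank o z) (rank o y')) => c.
    apply: H => //; exists x, y, z, x', y', z'; split=> //.
    by split=> //; apply: rank_inj exx.
  case: (leqP (rank o z') (rank o y)) => c'.
    apply: int_disjointC; apply: H; rewrite 1?eq_sym //.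
    exists x', y', z', x, y, z; split=> //.
    by split=> //; apply/esym => //; apply: rank_inj exx.
  have ey : y = y'.
    by apply: (@rank_inj _ o); move: (h _ yQ') (h' _ yQ) c c' => [_ +] [_ +]; clear; lia.
  have ez : z = z'.
    apply: (@rank_inj _ o); move: (h _ zQ') (h' _ zQ) r r' => [_ +] [_ +].
    by rewrite ey; clear; lia.
  by case/eqP: nt; rewrite te te' ey ez (rank_inj exx).
move=> [x [y [z [x' [y' [z' [[_ _ _ ->] [_ _ _ ->] r r' [e1 h e]]]]]]]] _ _ _.
move: r' => {e1}; rewrite -e => {x' e} r'.
apply/int_disjointP; exists x, z.
have hxz : rank o x < rank o z by move: r; clear; lia.
split; first by apply/eqP => e; move: hxz; rewrite e ltnn.
  by apply: sub_set3; rewrite (in_cyc_le _ (ltnW hxz)); move: r; clear; lia.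
by apply: sub_set3; rewrite (in_cyc_gt _ hxz); move: r r' h; clear; lia.
Qed.

(** The fan triangle whose base runs from the middle vertex [y] of [t] to the next vertex of [Q]
    also has [y] as its middle vertex, hence overlaps [t]. *)
Lemma fan_cover n (o : 'I_n) (Q t : {set 'I_n}) : #|t| = 3 -> t \subset Q ->
  exists2 f, f \in fan o Q & ~~ int_disjoint t f.
Proof.
move=> ht /subsetP tQ.
have [y] := card_mid_triangle o ht; move/setP/(_ y); rewrite in_set1 eqxx.
move=> /midP[x [z [yt xt zt r]]].
have [m mQ hm] := @arg_minnP _ y (mem Q) (rank o) (tQ _ yt).
have hz : (z \in Q) && (rank o y < rank o z) by rewrite tQ //; case/andP: r.
have [w /andP[wQ hw] hmw] :=
  @arg_minnP _ z [pred w | (w \in Q) && (rank o y < rank o w)] (rank o) hz.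
exists [set m; y; w].
  apply/fanP; exists m, y, w; split=> //; first by split=> //; apply: tQ.
    by move: r (hm _ (tQ _ xt)) hw; clear; lia.
  move=> u uQ; split; first exact: hm.
  case: (leqP (rank o u) (rank o y)) => //= c; apply: hmw.
  by rewrite /= uQ.
apply/negP => /int_disjointP[s1 [s2 [/(rank_neq o) ns h h']]].
have [i1 i2 i3] := in_set3 m y w.
move: r hw (hmw _ hz) (hm _ (tQ _ xt)) (h _ xt) (h _ yt) (h _ zt) (h' _ i1) (h' _ i2) (h' _ i3) ns.
by rewrite !(in_cyc o); clear; lia.
Qed.

Lemma fan_subdivision n (o : 'I_n) (Q : {set 'I_n}) : subdivision Q (fan o Q).
Proof.
apply/and3P; split; apply/forallP => t.
- by apply/implyP => /fan_triangle[-> ->].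
- apply/implyP => ft; apply/forallP => t'; apply/implyP => ft'; apply/implyP.
  exact: (fan_disjoint ft ft').
- apply/implyP => /andP[/eqP ht tQ]; have [f fQ nd] := fan_cover o ht tQ.
  by apply/existsP; exists f; rewrite fQ.
Qed.

(** All black polygons are fanned from [a]. Only the piece containing both [a] and [b] can have
    vertices strictly on both sides of the chord, and its diagonals all start at [a]. Hence [area]
    never takes its default value on a compatible arc. *)
Lemma uncut_triangulation n (s : bicolored n) (a b : 'I_n) :
  subdivision [set: 'I_n] (pieces s) -> compatible s a b ->
  exists2 TT, triangulation (black s) TT &
    forall t, t \in TT -> (t \subset cyc a b) || (t \subset cyc b a).
Proof.
move=> sd /andP[nab /existsP[Q0 /and3P[hQ0 aQ0 bQ0]]].
have [_ h2 _] := subdivisionP sd.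
have bp Q : Q \in black s -> Q \in pieces s by move=> h; rewrite in_setU h.
exists (\bigcup_(Q in black s) fan a Q)%SET.
  apply/triangulationP; split=> [t /bigcupP[Q QB /fan_triangle[ht tQ]]|Q QB].
    by split=> //; exists Q.
  suff -> : [set t in \bigcup_(Q in black s) fan a Q | t \subset Q]%SET = fan a Q.
    exact: fan_subdivision.
  apply/setP => t; rewrite in_set; apply/andP/idP => [[/bigcupP[Q' QB' ft] tQ]|ft].
    have [ht tQ'] := fan_triangle ft.
    case: (eqVneq Q Q') => [->//|nQ].
    by case: (common_triangle (h2 _ _ (bp _ QB) (bp _ QB') nQ) ht tQ tQ').
  by split; [apply/bigcupP; exists Q | case: (fan_triangle ft)].
move=> t /bigcupP[Q QB ft]; have [ht tQ] := fan_triangle ft.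
case: (eqVneq Q Q0) => [e|nQ]; last first.
  rewrite eq_sym in nQ.
  case/orP: (int_disjoint_side (h2 _ _ hQ0 (bp _ QB) nQ) aQ0 bQ0 nab) => h.
    by rewrite (subset_trans tQ h).
  by rewrite (subset_trans tQ h) orbT.
rewrite -e in aQ0 bQ0.
have [x [y [z [[xQ yQ zQ] te r h]]]] := fanP _ _ _ ft.
have xa : x = a.
  by apply: (@rank_inj _ a); move: (h _ aQ0) => [+ _]; rewrite rankoo; clear; lia.
have [_ hb] := h _ bQ0; rewrite te xa; move: nab (rank_gt0 a b) r hb.
rewrite xa eq_sym => -> b0 r /orP hb; apply/orP.
case: hb => hb; [right|left]; apply/subsetP; apply: sub_set3;
  by rewrite (in_cyc a) rankoo; move: b0 r hb; rewrite rankoo; clear; lia.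
Qed.

Lemma areaE n (s : bicolored n) (a b : 'I_n) :
  subdivision [set: 'I_n] (pieces s) -> compatible s a b ->
  area s a b = left_area (black s) a b.
Proof.
move=> sd cab; have [_ h2 _] := subdivisionP sd.
have dj Q Q' : Q \in black s -> Q' \in black s -> Q != Q' -> int_disjoint Q Q'.
  by move=> h h'; apply: h2; rewrite in_setU ?h ?h'.
rewrite /area; case: pickP => [TT /andP[tT /forallP cut]|no].
  apply: card_triangulation_left => // t ht.
  by move: (cut t); rewrite ht.
have [TT tT cut] := uncut_triangulation sd cab.
move: (no TT); rewrite tT /= => /negP; case; apply/forallP => t.
by apply/implyP/cut.
Qed.

Lemma compatible_sym n (s : bicolored n) a b : compatible s a b = compatible s b a.
Proof.
by rewrite /compatible eq_sym; congr andb; apply: eq_existsb => Q; rewrite [X in _ && X]andbC.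
Qed.

(** An uncut triangulation has [k] triangles, each on exactly one side of the chord. *)
Lemma area_rev n k (s : bicolored n) (a b : 'I_n) :
  bicolored_subdivision k s -> compatible s a b -> area s a b + area s b a = k.
Proof.
move=> [sd _ _ hk] cab; have [_ h2 _] := subdivisionP sd.
have dj Q Q' : Q \in black s -> Q' \in black s -> Q != Q' -> int_disjoint Q Q'.
  by move=> h h'; apply: h2; rewrite in_setU ?h ?h'.
have [TT tT cut] := uncut_triangulation sd cab.
have nab : a != b by case/andP: cab.
rewrite !areaE // 1?compatible_sym // -(card_triangulation_left dj tT cut).
rewrite -(@card_triangulation_left _ _ TT b a) //; last by move=> t /cut; rewrite orbC.
rewrite -(hk _ tT) -cardsUI.
have -> : [set t in TT | t \subset cyc a b] :&: [set t in TT | t \subset cyc b a] = finset.set0.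
  apply/setP => t; rewrite !in_set; apply/negP => /andP[/andP[tt /subsetP h] /andP[_ /subsetP h']].
  have ht : #|t| = 3 by have [/(_ _ tt)[]] := (triangulationP _ _).1 tT.
  have [v] := card_mid_triangle a ht; move/setP/(_ v); rewrite in_set1 eqxx.
  move=> /midP[x [y [vt xt yt r]]].
  move: (h _ vt) (h' _ vt) (h _ yt) r (rank_neq a nab); rewrite !(in_cyc a) rankoo; clear; lia.
rewrite cards0 addn0; apply: eq_card => t; rewrite !in_set -andb_orr.
by case tt : (t \in TT) => //=; apply: cut.
Qed.

(** Any other piece lies beyond one side of the triangle [{a, v, b}], so it contributes to at most
    one of the two smaller arcs. The piece [Q], if black, contributes the triangle itself in
    addition. *)
Lemma area_split n (s : bicolored n) (Q : {set 'I_n}) a v b :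
  subdivision [set: 'I_n] (pieces s) -> Q \in pieces s ->
  a \in Q -> v \in Q -> b \in Q -> btw a v b ->
  area s a b = area s a v + area s v b + (Q \in black s).
Proof.
move=> sd QP aQ vQ bQ hb; have [nva nvb nab] := btwW hb.
have cmp x y : x != y -> x \in Q -> y \in Q -> compatible s x y.
  by move=> nxy xQ yQ; rewrite /compatible nxy; apply/existsP; exists Q; rewrite QP xQ yQ.
rewrite !areaE //; try by apply: cmp; rewrite // eq_sym.
rewrite /left_area -big_split /=.
have [_ h2 _] := subdivisionP sd.
have subs (X Y : {set 'I_n}) z : (forall u, u \in X -> u \in Y -> u = z) -> #|X :&: Y| - 2 = 0.
  move=> h; have : #|X :&: Y| <= 1; last by clear; case: #|_| => [|[]].
  rewrite -(cards1 z); apply: subset_leq_card; apply/subsetP => u.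
  by rewrite in_setI in_set1 => /andP[/h h0 /h0 ->].
have oth Q' : Q' \in black s -> Q' != Q ->
    #|Q' :&: cyc a b| - 2 = #|Q' :&: cyc a v| - 2 + (#|Q' :&: cyc v b| - 2).
  move=> QB'; rewrite eq_sym => nQ; have QP' : Q' \in pieces s by rewrite in_setU QB'.
  have b0 : 0 < rank a b by rewrite rank_gt0 eq_sym.
  have v0 : 0 < rank a v by rewrite rank_gt0.
  case/or3P: (int_disjoint_side3 (h2 _ _ QP QP' nQ) aQ vQ bQ hb) => /subsetP h.
  - rewrite (subs _ (cyc v b) v) ?addn0.
      congr subn; apply: eq_card => u; rewrite !in_setI; case uQ: (u \in Q') => //=.
      by move: (h _ uQ) hb; rewrite !(in_cyc a) (btwE a) !rankoo; clear; lia.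
    by move=> u /h + h'; move: h' hb; rewrite !(in_cyc a) (btwE a) !rankoo;
      move=> e1 e2 e3; apply: (@rank_inj _ a); rewrite ?rankoo; move: e1 e2 e3; clear; lia.
  - rewrite (subs _ (cyc a v) v) ?add0n.
      congr subn; apply: eq_card => u; rewrite !in_setI; case uQ: (u \in Q') => //=.
      by move: (h _ uQ) hb; rewrite !(in_cyc a) (btwE a) !rankoo; clear; lia.
    by move=> u /h + h'; move: h' hb; rewrite !(in_cyc a) (btwE a) !rankoo;
      move=> e1 e2 e3; apply: (@rank_inj _ a); rewrite ?rankoo; move: e1 e2 e3; clear; lia.
  rewrite (subs _ (cyc a v) a); last first.
    by move=> u /h + h'; move: h' hb; rewrite !(in_cyc a) (btwE a) !rankoo;
      move=> e1 e2 e3; apply: (@rank_inj _ a); rewrite ?rankoo; move: e1 e2 e3; clear; lia.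
  rewrite (subs _ (cyc v b) b); last first.
    by move=> u /h + h'; move: h' hb; rewrite !(in_cyc a) (btwE a) !rankoo;
      move=> e1 e2 e3; apply: (@rank_inj _ a); rewrite ?rankoo; move: e1 e2 e3; clear; lia.
  rewrite addn0; apply/eqP; rewrite subn_eq0; have <- : #|[set a; b]| = 2 by rewrite cards2 nab.
  apply: subset_leq_card; apply/subsetP => u; rewrite !in_setI => /andP[/h h1 h3].
  have : (rank a u == rank a a) || (rank a u == rank a b).
    by move: h1 h3 hb; rewrite !(in_cyc a) (btwE a) !rankoo; clear; lia.
  by rewrite !(inj_eq (@rank_inj _ a)) in_set2.
case: (boolP (Q \in black s)) => QB; last first.
  rewrite addn0; apply: eq_bigr => Q' QB'; apply: oth => //.
  by apply: contraNneq QB => <-.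
rewrite (bigD1 Q) //= [RHS]addnC [in RHS](bigD1 Q) //= addnA; congr addn; last first.
  by apply: eq_bigr => Q' /andP[]; apply: oth.
have c2' (x y : 'I_n) : x != y -> x \in Q -> y \in Q -> 1 < #|Q :&: cyc x y|.
  move=> nxy xQ yQ; have <- : #|[set x; y]| = 2 by rewrite cards2 nxy.
  apply: subset_leq_card; apply/subsetP => u; rewrite in_set2 in_setI in_cyc_btw.
  by case/orP => /eqP->; rewrite ?xQ ?yQ eqxx ?orbT.
have c1 : 1 < #|Q :&: cyc a v| by apply: c2'; rewrite 1?eq_sym.
have c2 : 1 < #|Q :&: cyc v b| by apply: c2'.
(* The two arcs share only [v], so [Q] has [p + q - 1] vertices on the whole arc, one triangle more
   than on the two parts together. *)
have ar p q r : 1 < p -> 1 < q -> r + 1 = p + q -> r - 2 = 1 + (p - 2 + (q - 2)).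
  by clear; lia.
apply: (ar _ _ _ c1 c2).
rewrite -(cards1 v) -[RHS]cardsUI; congr addn; apply: eq_card => u.
  rewrite !(in_setU, in_setI) -andb_orr; congr andb.
  by move: hb; rewrite !(in_cyc a) (btwE a) !rankoo; clear; lia.
rewrite !(in_setI, in_set1) -(inj_eq (@rank_inj _ a)).
case: (boolP (u \in Q)) => uQ /=.
  by move: hb; rewrite !(in_cyc a) (btwE a) !rankoo; clear; lia.
by apply: contraNF uQ => /eqP/rank_inj->.
Qed.

(** * Points in general position *)

Lemma rank_ordS n (a : 'I_n) : 1 < n -> rank a (ordS a) = 1.
Proof.
move=> hn; have ha := ltn_ord a.
have Sa : nat_of_ord (ordS a) = if a.+1 == n then 0 else a.+1.
  rewrite /=; case: eqP => [e|ne]; first by rewrite [X in X %% _]e modnn.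
  by rewrite modn_small //; move: ne ha; clear; lia.
by move: (rankP a (ordS a)); rewrite Sa; case: (a.+1 =P n); move: hn ha; clear; lia.
Qed.

Lemma val_ord_pred n (b : 'I_n) :
  ord_pred b = (if b == 0 :> nat then n.-1 else b.-1) :> nat.
Proof.
have hb := ltn_ord b; rewrite /=; case: eqP => [->|b0].
  by rewrite add0n modn_small //; move: hb; clear; lia.
have -> : (b + n).-1 = b.-1 + n by move: b0; clear; lia.
by rewrite modnDr modn_small //; move: hb; clear; lia.
Qed.

Lemma rank_pred_max n (o v : 'I_n) : rank o v <= rank o (ord_pred o).
Proof.
have ho := ltn_ord o; move: (rankP o (ord_pred o)) (rank_lt o v).
by rewrite val_ord_pred; case: (o =P 0 :> nat); move: ho; clear; lia.
Qed.

Lemma rank_pred n (a b : 'I_n) : a != b -> rank a (ord_pred b) = (rank a b).-1.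
Proof.
move=> nab; have hb := ltn_ord b; have ha := ltn_ord a.
have nab' : nat_of_ord a != b by [].
move: (rankP a b) (rankP a (ord_pred b)); rewrite val_ord_pred.
by case: (b =P 0 :> nat); move: nab' ha hb; clear; lia.
Qed.

Lemma in_arc n (a b v : 'I_n) : a != b ->
  (v \in cyc a (ord_pred b)) = (rank a v < rank a b).
Proof.
move=> nab; rewrite (in_cyc a) rankoo rank_pred //.
by have := rank_gt0 a b; rewrite eq_sym nab; clear; lia.
Qed.

(** * Sums over half-open arcs *)

Section ArcSums.
Variables (V : nmodType) (n : nat) (F : 'I_n -> V).
Local Open Scope ring_scope.

Lemma sum_arc_split a v b : btw a v b ->
  \sum_(u in cyc a (ord_pred b)) F u =
  \sum_(u in cyc a (ord_pred v)) F u + \sum_(u in cyc v (ord_pred b)) F u.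
Proof.
move=> h; have [nva nvb nab] := btwW h.
rewrite (bigID (fun u => rank a u < rank a v)%N) /=; congr +%R; apply: eq_bigl => u.
  by rewrite !in_arc // 1?eq_sym //; move: h; rewrite (btwE a) rankoo; clear; lia.
rewrite !in_arc //; move: h (rank_shift a v u) (rank_shift a v b) (rank_lt a b) (rank_lt a u).
by rewrite (btwE a) rankoo; clear; lia.
Qed.

Lemma sum_arc_compl a b : a != b ->
  \sum_(u in cyc a (ord_pred b)) F u + \sum_(u in cyc b (ord_pred a)) F u
  = \sum_u F u.
Proof.
move=> nab; rewrite [RHS](bigID (fun u => rank a u < rank a b)%N) /=.
congr +%R; apply: eq_bigl => u; rewrite !in_arc // 1?eq_sym //.
have := rank_gt0 a b; rewrite eq_sym nab.
move: (rank_shift a b u) (rank_shift a b a) (rank_lt a b) (rank_lt a u).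
by rewrite rankoo; clear; lia.
Qed.

Lemma sum_arc_ordS a : (1 < n)%N -> \sum_(u in cyc a (ord_pred (ordS a))) F u = F a.
Proof.
move=> hn; have nS : a != ordS a by rewrite eq_sym -rank_gt0 rank_ordS.
rewrite (big_pred1 a) // => u; rewrite in_arc // rank_ordS // ltnS leqn0.
by rewrite -(rankoo a) (inj_eq (@rank_inj _ a)).
Qed.

End ArcSums.

Lemma rank_ge2 n (a b : 'I_n) : a != b -> b != ordS a -> btw a (ordS a) b.
Proof.
move=> nab nb.
have hn : 1 < n.
  by case: n a b nab {nb} => [[]//|[|//]] a b; rewrite (ord1 a) (ord1 b).
rewrite (btwE a) rank_ordS // rankoo.
have := rank_neq a nb; rewrite rank_ordS //; have := rank_gt0 a b; rewrite eq_sym nab.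
by clear; lia.
Qed.

Lemma rank_btw_lt n (a v b : 'I_n) : btw a v b ->
  rank a v < rank a b /\ rank v b < rank a b.
Proof.
rewrite (btwE a) rankoo => h; move: h (rank_shift a v b) (rank_lt a b); clear; lia.
Qed.

(** * Tiles and orientations of triangles *)

Section Points.
Variables (R : realType) (n : nat).
Hypothesis n_gt1 : 1 < n.
Local Open Scope ring_scope.
Implicit Types (phi : 'I_n -> R) (a b v : 'I_n).

Definition des phi v : bool := phi (ordS v) < phi v.

Definition arcdes phi a b : nat := (\sum_(v in cyc a (ord_pred b)) des phi v)%N.

(** For values in an open interval of length 1, adding 1 at each descent selects the representative
    of the difference modulo 1 that lies in the unit interval. *)
Definition pt phi : 'rV[R]_n := \row_v (phi (ordS v) - phi v + (des phi v)%:R).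

Lemma sum_arc_telescope phi a b : a != b ->
  \sum_(v in cyc a (ord_pred b)) (phi (ordS v) - phi v) = phi b - phi a.
Proof.
elim: {b}_.+1 {-2}b (ltnSn (rank a b)) => // m IH b hm nab.
case: (eqVneq b (ordS a)) => [->|nb]; first by rewrite sum_arc_ordS.
have Pb : ordS (ord_pred b) = b by rewrite ord_predK.
have hb := rank_gt0 a b; rewrite eq_sym nab in hb.
have nPa : a != ord_pred b by apply: contraNneq nb => ->; rewrite Pb.
have h : btw a (ord_pred b) b.
  rewrite (btwE a) rankoo; have := rank_gt0 a (ord_pred b).
  by rewrite eq_sym nPa rank_pred //; move: hb; clear; lia.
rewrite (sum_arc_split _ h) IH //; last first.
  by rewrite rank_pred //; move: hb hm; clear; lia.
have := sum_arc_ordS (fun u => phi (ordS u) - phi u) (ord_pred b) n_gt1.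
by rewrite Pb => ->; rewrite addrC addrA subrK.
Qed.

(** The differences telescope, so an arc sum is an integer plus a number of absolute value less than
    1; in general position this number is not 0. *)
Lemma xarc_pt phi a b : a != b ->
  xarc a b (pt phi) = (arcdes phi a b)%:R + (phi b - phi a).
Proof.
move=> nab; rewrite /xarc /xsum /arcdes natr_sum -sum_arc_telescope // -big_split /=.
by apply: eq_bigr => v _; rewrite mxE addrC.
Qed.

Lemma xsum_pt phi : xsum [set: 'I_n] (pt phi) = (\sum_v des phi v)%:R.
Proof.
have -> : xsum [set: 'I_n] (pt phi) = \sum_v (phi (ordS v) - phi v + (des phi v)%:R).
  by apply: eq_big => v; rewrite ?in_setT // mxE.
rewrite big_split sumrB /= natr_sum.
rewrite [X in X - _ + _](_ : _ = \sum_v phi v) ?subrr ?add0r //.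
by rewrite [RHS](reindex_inj (can_inj (@ordSK n))).
Qed.

Definition in_general_position phi : Prop :=
  injective phi /\ forall v, - (1/2) < phi v < 1/2.

Lemma int_between (D A : nat) (d : R) (e : bool) :
  (if e then -1 < d < 0 else 0 < d < 1) ->
  A%:R <= D%:R + d <= A%:R + 1 -> (A + e = D)%N.
Proof.
move=> hd h; have h1 : (A + e < D.+1)%N.
  rewrite -(ltr_nat R) -natr1 natrD; case: e hd => /andP[? ?]; case/andP: h => ? ? /=; lra.
have h2 : (D < (A + e).+1)%N.
  rewrite -(ltr_nat R) -natr1 natrD; case: e hd {h1} => /andP[? ?]; case/andP: h => ? ? /=; lra.
by move: h1 h2; clear; lia.
Qed.

Lemma phi_diff phi a b : in_general_position phi -> a != b ->
  if phi b < phi a then -1 < phi b - phi a < 0 else 0 < phi b - phi a < 1.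
Proof.
move=> [inj bd] nab; have /andP[a1 a2] := bd a; have /andP[b1 b2] := bd b.
have : phi b != phi a by rewrite (inj_eq inj) eq_sym.
by case: (ltgtP (phi b) (phi a)) => // h _; apply/andP; split; lra.
Qed.

(** No arc sum is an integer, so each pair of tile inequalities pins down its integer part:
    membership becomes a system of equations between natural numbers. *)
Lemma tile_ptP phi k s : in_general_position phi ->
  tile k s (pt phi) <-> (\sum_v des phi v = k.+1)%N /\
    forall a b, compatible s a b ->
      (area s a b + (phi b < phi a)%R = arcdes phi a b)%N.
Proof.
move=> gp; rewrite /tile /hyperplane /= xsum_pt; split=> -[h1 h2].
  split; first by apply/eqP; rewrite -(eqr_nat R) h1.
  move=> a b cab; have nab : a != b by case/andP: (cab).
  by apply: int_between (phi_diff gp nab) _; rewrite -xarc_pt // h2.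
split=> [|a b cab]; first by rewrite h1.
have nab : a != b by case/andP: (cab).
rewrite xarc_pt // -(h2 _ _ cab) natrD.
by have := phi_diff gp nab; case: ifP => _ /andP[? ?] /=; apply/andP; split; lra.
Qed.

(** The excess of the two descents along [a], [v], [b] over the one from [a] to [b] is 0 if the
    values of [phi] have the cyclic order of the vertices, and 1 if they have the opposite one. *)
Definition oriented phi s : Prop := forall Q a v b, Q \in pieces s ->
  a \in Q -> v \in Q -> b \in Q -> btw a v b ->
  ((phi v < phi a)%R + (phi b < phi v)%R = (phi b < phi a)%R + (Q \in black s))%N.

(** Descent counts are additive along arcs, and areas are additive up to the colour of [Q];
    comparing the tile equations of the three sides leaves the orientation. *)
Lemma tile_oriented phi k s : in_general_position phi ->
  bicolored_subdivision k s -> tile k s (pt phi) -> oriented phi s.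
Proof.
move=> gp [sd _ _ _] /(tile_ptP _ _ gp)[_ h] Q a v b QP aQ vQ bQ hb.
have [nva nvb nab] := btwW hb.
have cmp x y : x != y -> x \in Q -> y \in Q -> compatible s x y.
  by move=> nxy xQ yQ; rewrite /compatible nxy; apply/existsP; exists Q; rewrite QP xQ yQ.
have := sum_arc_split (fun u => nat_of_bool (des phi u)) hb; rewrite -!/(arcdes _ _ _).
rewrite -!h ?cmp // 1?eq_sym // (area_split sd QP aQ vQ bQ hb).
by clear; lia.
Qed.

(** Induction on the distance from [a] to [b]: a boundary edge has area 0, and any longer arc is the
    base of a triangle inside a piece, whose other two sides span shorter arcs. *)
Lemma oriented_arcdes phi s a b : in_general_position phi ->
  subdivision [set: 'I_n] (pieces s) -> oriented phi s -> compatible s a b ->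
  (area s a b + (phi b < phi a)%R = arcdes phi a b)%N.
Proof.
move=> gp sd ori.
elim: {a b}_.+1 {-2}a {-2}b (ltnSn (rank a b)) => // m IH a b hm cab.
have nab : a != b by case/andP: (cab).
case: (eqVneq b (ordS a)) => [e|nb].
  rewrite areaE // /arcdes e sum_arc_ordS // /des [left_area _ _ _]big1 ?add0n // => Q _.
  apply/eqP; rewrite subn_eq0 -e.
  have <- : #|[set a; b]| = 2%N by rewrite cards2 nab.
  apply: subset_leq_card; apply/subsetP => u.
  rewrite in_setI => /andP[_]; rewrite in_set2 in_cyc_btw.
  case/or3P=> [->|->|]; rewrite ?orbT //.
  by rewrite /btw e rank_ordS //; clear; lia.
have [Q [v [QP aQ bQ vQ hb]]] := compatible_btw sd cab (rank_ge2 nab nb).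
have [nva nvb _] := btwW hb.
have cmp x y : x != y -> x \in Q -> y \in Q -> compatible s x y.
  by move=> nxy xQ yQ; rewrite /compatible nxy; apply/existsP; exists Q; rewrite QP xQ yQ.
have [r1 r2] := rank_btw_lt hb.
rewrite /arcdes (sum_arc_split _ hb) -!/(arcdes _ _ _).
rewrite -(IH a v) ?cmp 1?eq_sym //; last by move: hm r1; clear; lia.
rewrite -(IH v b) ?cmp //; last by move: hm r2; clear; lia.
have := ori _ _ _ _ QP aQ vQ bQ hb; rewrite (area_split sd QP aQ vQ bQ hb).
by clear; lia.
Qed.

Lemma arcdes_rev phi a b : a != b ->
  (arcdes phi a b + arcdes phi b a = \sum_v des phi v)%N.
Proof. exact: sum_arc_compl. Qed.

Lemma oriented_tile phi k s a b : in_general_position phi ->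
  bicolored_subdivision k s -> compatible s a b -> oriented phi s -> tile k s (pt phi).
Proof.
move=> gp bs cab ori; have [sd _ _ _] := bs.
apply/(tile_ptP _ _ gp); split; last by move=> x y; apply: oriented_arcdes.
have nab : a != b by case/andP: (cab).
(* The areas on the two sides add up to [k], and exactly one of the two directions of the chord is a
   descent, which gives the total [k + 1]. *)
rewrite -(arcdes_rev phi nab) -!(oriented_arcdes gp sd ori) // 1?compatible_sym //.
have := area_rev bs cab; have : phi a != phi b by rewrite (inj_eq gp.1).
by case: (ltgtP (phi a) (phi b)) => //= _ _; clear; lia.
Qed.

End Points.

(** * Points near a chord *)

Lemma internalP n (i j : 'I_n) : internal i j -> [/\ i != j, ordS i != j & ordS j != i].
Proof.
have aux (a b : 'I_n) : 1 < n -> ordS a = b -> edge [set: 'I_n] a b || (a == b).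
  move=> hn e; case: eqVneq => nab //=; rewrite ?orbT // orbF.
  apply/and4P; split; rewrite ?in_setT //; apply/orP; right; apply/subsetP => v _.
  rewrite in_cyc_btw; case: eqVneq => //= nvb; case: eqVneq => //= nva.
  have := @btwT _ a v b nab nva nvb; case/orP => //.
  by rewrite /btw -e rank_ordS //; clear; lia.
move=> /andP[nij ne].
have hn : 1 < n.
  by case: n i j nij {ne aux} => [[]//|[|//]] a b; rewrite (ord1 a) (ord1 b).
split=> //; apply/eqP => e; have := aux _ _ hn e.
  by rewrite (negPf ne) (negPf nij).
rewrite [j == i]eq_sym (negPf nij) orbF => h; case/negP: ne.
case/and4P: h => h1 h2 h3 h4; apply/and4P; split=> //; by rewrite orbC.
Qed.

(** * Orientation of three real numbers *)

Section Orientation.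
Variable (R : realType).
Local Open Scope ring_scope.
Implicit Types x y z : R.

(** As [z] exceeds the others in absolute value, it compares in the same way with [x] and with [y],
    and its two terms cancel; [y] compares with [x] as with 0. *)
Lemma orient_mid x y z : `|x| < `|y| < `|z| ->
  ((y < x)%R + (z < y)%R = (z < x)%R + (y < 0)%R)%N.
Proof.
case/andP; rewrite ltr_norml; case: (ltP y 0) => hy; case: (ltP z 0) => hz.
- rewrite !ltr0_norm // => /andP[? ?] ?.
  have -> : y < x by lra.
  have -> : z < y by lra.
  by have -> : z < x by lra.
- rewrite (ltr0_norm hy) (ger0_norm hz) => /andP[? ?] ?.
  have -> : y < x by lra.
  have -> : (z < y) = false by apply/negP; lra.
  by have -> : (z < x) = false by apply/negP; lra.
- rewrite (ger0_norm hy) (ltr0_norm hz) => /andP[? ?] ?.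
  have -> : (y < x) = false by apply/negP; lra.
  have -> : z < y by lra.
  by have -> : z < x by lra.
- rewrite (ger0_norm hy) (ger0_norm hz) => /andP[? ?] ?.
  have -> : (y < x) = false by apply/negP; lra.
  have -> : (z < y) = false by apply/negP; lra.
  by have -> : (z < x) = false by apply/negP; lra.
Qed.

Lemma orient_rot x y z (q : nat) : x != z -> x != y ->
  ((y < x)%R + (z < y)%R = (z < x)%R + q)%N ->
  ((z < y)%R + (x < z)%R = (x < y)%R + q)%N.
Proof.
by case: (ltgtP x y) => //= _ + _; case: (ltgtP x z) => //= _ _; clear; lia.
Qed.

End Orientation.

(** * Sign patterns on the two sides of a chord *)

Section Chord.
Variables (R : realType) (n : nat).
Hypothesis n_gt1 : 1 < n.
Local Open Scope ring_scope.
Implicit Types (i j a b v : 'I_n) (eps : 'I_n -> R) (tau : R) (s : {set 'I_n}).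

(** The absolute values: [tau] at both ends of the chord, [eps] elsewhere. The conditions are
    symmetric in [i] and [j], so an argument on one side of the chord serves for the other. *)
Definition arc_increasing i j eps tau : Prop :=
  [/\ 0 < tau < 1/2, injective eps,
      forall v, v != i -> v != j -> tau < eps v < 1/2,
      forall a b, btw i a b -> btw i b j -> eps a < eps b &
      forall a b, btw j a b -> btw j b i -> eps a < eps b].

Lemma arc_increasing_sym i j eps tau :
  arc_increasing i j eps tau -> arc_increasing j i eps tau.
Proof. by case=> h1 h2 h3 h4 h5; split=> // v vj vi; apply: h3. Qed.

(** The set [s] is the sign pattern, the vertices with negative value away from the chord.
    Exchanging the arguments [i] and [j] crosses the wall. *)
Definition chord_fun eps tau i j s v : R :=
  if v == i then - tau else if v == j then tau
  else if v \in s then - eps v else eps v.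

Variables (eps : 'I_n -> R) (tau : R).
Local Notation phi := (chord_fun eps tau).

Lemma chord_funl i j s : phi i j s i = - tau.
Proof. by rewrite /chord_fun eqxx. Qed.

Lemma chord_funr i j s : i != j -> phi i j s j = tau.
Proof. by move=> nij; rewrite /chord_fun eq_sym (negPf nij) eqxx. Qed.

Lemma chord_fun_other i j s v : v != i -> v != j ->
  phi i j s v = if v \in s then - eps v else eps v.
Proof. by rewrite /chord_fun => /negPf-> /negPf->. Qed.

(** No other value lies between [- tau] and [tau], so the exchange reverses no comparison but that
    of [i] with [j]. *)
Lemma chord_fun_lt i j s a b : i != j -> arc_increasing i j eps tau -> a != b ->
  ~~ ((a == i) && (b == j)) -> ~~ ((a == j) && (b == i)) ->
  (phi i j s b < phi i j s a) = (phi j i s b < phi j i s a).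
Proof.
move=> nij [/andP[t0 _] _ bd _ _] nab; have nji : j != i by rewrite eq_sym.
have oth v : v != i -> v != j ->
    phi i j s v = phi j i s v /\ (phi j i s v < - tau \/ tau < phi j i s v).
  move=> vi vj; rewrite !chord_fun_other //; split=> //.
  by have /andP[? ?] := bd _ vi vj; case: ifP => _; [left|right]; lra.
case: (eqVneq a i) nab => [->|nai].
  rewrite eq_sym (negPf nij) /= => nbi nbj _; have [-> h] := oth _ nbi nbj.
  by rewrite chord_funl chord_funr //; apply/idP/idP => ?; case: h => ?; lra.
case: (eqVneq a j) => [->|naj].
  rewrite eq_sym /= => nbj _ nbi; have [-> h] := oth _ nbi nbj.
  by rewrite chord_funl chord_funr //; apply/idP/idP => ?; case: h => ?; lra.
move=> _ _ _; have [-> h] := oth _ nai naj.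
case: (eqVneq b i) => [->|nbi].
  by rewrite chord_funl chord_funr //; apply/idP/idP => ?; case: h => ?; lra.
case: (eqVneq b j) => [->|nbj].
  by rewrite chord_funl chord_funr //; apply/idP/idP => ?; case: h => ?; lra.
by have [-> _] := oth _ nbi nbj.
Qed.

Lemma chord_des i j s v : internal i j -> arc_increasing i j eps tau ->
  des (phi i j s) v = des (phi j i s) v.
Proof.
move=> /internalP[nij ni nj] ai; rewrite /des; apply: chord_fun_lt => //.
- by rewrite eq_sym -rank_gt0 rank_ordS.
- by apply/negP => /andP[/eqP-> /eqP e]; rewrite e eqxx in ni.
- by apply/negP => /andP[/eqP-> /eqP e]; rewrite e eqxx in nj.
Qed.

Lemma chord_arcdes i j s a b : internal i j -> arc_increasing i j eps tau ->
  arcdes (phi i j s) a b = arcdes (phi j i s) a b.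
Proof. by move=> ij ai; apply: eq_bigr => v _; rewrite chord_des. Qed.

Lemma chord_general_position i j s : i != j -> arc_increasing i j eps tau ->
  in_general_position (phi i j s).
Proof.
move=> nij [/andP[t0 t1] inj bd _ _].
have oth v : v != i -> v != j -> phi i j s v < - tau \/ tau < phi i j s v.
  move=> vi vj; rewrite !chord_fun_other //.
  by have /andP[? ?] := bd _ vi vj; case: ifP => _; [left|right]; lra.
split=> [a b|v]; last first.
  case: (eqVneq v i) => [->|vi]; first by rewrite chord_funl; apply/andP; split; lra.
  case: (eqVneq v j) => [->|vj]; first by rewrite chord_funr //; apply/andP; split; lra.
  rewrite chord_fun_other //; have /andP[? ?] := bd _ vi vj.
  by case: ifP => _; apply/andP; split; lra.
case: (eqVneq a i) => [->|ai]; case: (eqVneq b i) => [->|bi] //.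
- rewrite chord_funl; case: (eqVneq b j) => [->|bj].
    by rewrite chord_funr // => ?; exfalso; lra.
  by case: (oth _ bi bj) => ? ?; exfalso; lra.
- rewrite chord_funl; case: (eqVneq a j) => [->|aj].
    by rewrite chord_funr // => ?; exfalso; lra.
  by case: (oth _ ai aj) => ? ?; exfalso; lra.
case: (eqVneq a j) => [->|aj]; case: (eqVneq b j) => [->|bj] //.
- by rewrite chord_funr //; case: (oth _ bi bj) => ? ?; exfalso; lra.
- by rewrite chord_funr //; case: (oth _ ai aj) => ? ?; exfalso; lra.
have /andP[? ?] := bd _ ai aj; have /andP[? ?] := bd _ bi bj.
rewrite !chord_fun_other //; case: ifP => _; case: ifP => _ e.
- by apply: inj; lra.
- by exfalso; lra.
- by exfalso; lra.
- exact: inj.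
Qed.

(* [p] is not fixed to be [phi i j s]: its hypotheses are symmetric in [i] and [j],
   which lets the lemma be applied on both sides of the chord. *)
Lemma norm_increasing i j (p : 'I_n -> R) (Q : {set 'I_n}) a v b :
  i != j -> arc_increasing i j eps tau -> `|p i| = tau -> `|p j| = tau ->
  (forall u, u != i -> u != j -> `|p u| = eps u) ->
  Q \subset cyc i j -> a \in Q -> v \in Q -> b \in Q ->
  (rank j a < rank j v < rank j b)%N -> v != i -> `|p a| < `|p v| < `|p b|.
Proof.
move=> nij [/andP[t0 _] _ bd h1 _] pi pj po /subsetP sQ aQ vQ bQ r vi.
have vj : v != j by rewrite -rank_gt0; move: r; clear; lia.
have bj : b != j by rewrite -rank_gt0; move: r; clear; lia.
have hi : (0 < rank j i)%N by rewrite rank_gt0.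
have := sQ _ vQ; rewrite in_cyc_btw (negPf vi) (negPf vj) /= => vl.
have bi : b != i.
  by apply/eqP => e; move: vl r; rewrite e (btwE j) rankoo; clear; lia.
have := sQ _ bQ; rewrite in_cyc_btw (negPf bi) (negPf bj) /= => bl.
rewrite (po _ vi vj) (po _ bi bj); apply/andP; split; last first.
  by apply: (h1 _ _ _ bl); move: vl bl r hi; rewrite !(btwE j) rankoo; clear; lia.
case: (eqVneq a i) => [->|ai]; first by rewrite pi; case/andP: (bd _ vi vj).
case: (eqVneq a j) => [->|aj]; first by rewrite pj; case/andP: (bd _ vi vj).
have := sQ _ aQ; rewrite in_cyc_btw (negPf ai) (negPf aj) /= => al.
rewrite po //; apply: (h1 _ _ _ vl).
by move: al vl r hi; rewrite !(btwE j) rankoo; clear; lia.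
Qed.

(** Left of the chord [ord_pred j] is last in the order from [j], and right of it [ord_pred i] is
    last in the order from [i]. Being the middle vertex of no piece there, they have no prescribed
    sign; leaving them out fixes it as positive and makes patterns unique. *)
Definition chord_support i j : {set 'I_n} :=
  ~: [set i; j; ord_pred i; ord_pred j].

(* The signs forced by a subdivision in which (i, j) is an edge: left of the chord
   a vertex takes the colour of the piece it is a middle vertex of when the order
   starts at [j], right of the chord when it starts at [i]. *)
Definition chord_signs (t : bicolored n) i j : {set 'I_n} :=
  [set v in chord_support i j |
     btw i v j && [exists Q in black t, v \in mid j Q]
  || btw j v i && [exists Q in black t, v \in mid i Q]].

Lemma chord_support_sym i j : chord_support i j = chord_support j i.
Proof.
apply/setP => v; rewrite !inE; do 4! case: (v == _) => //=.
Qed.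

Lemma chord_signs_sym t i j : chord_signs t i j = chord_signs t j i.
Proof. by apply/setP => v; rewrite 2![_ \in chord_signs _ _ _]in_set chord_support_sym orbC. Qed.

Lemma btw_asym i v j : btw i v j -> btw j v i = false.
Proof. by rewrite !(btwE i); clear; lia. Qed.

Lemma in_chord_support i v j : v != i -> v != j -> v != ord_pred i -> v != ord_pred j ->
  v \in chord_support i j.
Proof. by move=> h1 h2 h3 h4; rewrite in_setC !in_setU !in_set1 !negb_or h1 h2 h3. Qed.

Lemma in_chord_signs k t i j (Q : {set 'I_n}) v : i != j -> bicolored_subdivision k t ->
  Q \in pieces t -> Q \subset cyc i j -> v \in mid j Q -> v != i ->
  (v \in chord_signs t i j) = (Q \in black t).
Proof.
move=> nij [sd _ _ _] QP /subsetP sQ vm vi.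
have /midP[a [b [vQ aQ bQ r]]] := vm.
have vj : v != j by rewrite -rank_gt0; move: r; clear; lia.
have := sQ _ vQ; rewrite in_cyc_btw (negPf vi) (negPf vj) /= => vl.
have vsup : v \in chord_support i j.
  apply: in_chord_support => //; apply/eqP => e.
    by move: vl (rank_pred_max i j); rewrite /btw -e; clear; lia.
  by move: r (rank_pred_max j b); rewrite -e; clear; lia.
rewrite in_set vsup vl (btw_asym vl) /= orbF.
apply/existsP/idP => [[Q' /andP[QB' m']]|QB]; last by exists Q; rewrite QB.
have [_ h2 _] := subdivisionP sd.
case: (eqVneq Q Q') => [->//|nQ].
have QP' : Q' \in pieces t by rewrite in_setU QB'.
by have := mid_unique vm m'; rewrite h2.
Qed.

Lemma facet_side k t i j : i != j -> bicolored_subdivision k t -> facet_defining t i j ->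
  forall Q, Q \in pieces t -> (Q \subset cyc i j) || (Q \subset cyc j i).
Proof.
move=> nij [sd _ _ _] /existsP[L /and3P[LB /and4P[_ iL jL _] sL]] Q QP.
have [_ h2 _] := subdivisionP sd.
case: (eqVneq L Q) => [<-|nQ]; first by rewrite sL.
by apply: int_disjoint_side (h2 _ _ _ QP nQ) iL jL nij; rewrite in_setU LB.
Qed.

Lemma compatible_facet t i j : facet_defining t i j -> compatible t i j.
Proof.
move=> /existsP[L /and3P[LB /and4P[nij iL jL _] sL]]; rewrite /compatible nij.
by apply/existsP; exists L; rewrite in_setU LB iL jL.
Qed.

Lemma chord_fun_norm i j s : i != j -> arc_increasing i j eps tau ->
  [/\ `|phi i j s i| = tau, `|phi i j s j| = tau &
      forall u, u != i -> u != j -> `|phi i j s u| = eps u].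
Proof.
move=> nij [/andP[t0 _] _ bd _ _]; rewrite chord_funl chord_funr // normrN gtr0_norm //.
split=> // u ui uj; rewrite chord_fun_other //; have /andP[? ?] := bd _ ui uj.
have ? : 0 < eps u by lra.
by case: ifP => _; rewrite ?normrN gtr0_norm.
Qed.

Lemma chord_fun_lt0 i j s v : arc_increasing i j eps tau -> v != i -> v != j ->
  (phi i j s v < 0) = (v \in s).
Proof.
move=> [/andP[t0 _] _ bd _ _] vi vj; rewrite chord_fun_other //; have /andP[? ?] := bd _ vi vj.
by case: ifP => _; [apply: idP|apply: negbTE]; rewrite -?leNgt; lra.
Qed.

(** The orientation is invariant under rotation of the triple, so triples in increasing order from a
    base point suffice. *)
Lemma oriented_rank (p : 'I_n -> R) (Q : {set 'I_n}) (q : nat) (o : 'I_n) :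
  injective p ->
  (forall a v b, a \in Q -> v \in Q -> b \in Q -> (rank o a < rank o v < rank o b)%N ->
     ((p v < p a)%R + (p b < p v)%R = (p b < p a)%R + q)%N) ->
  forall a v b, a \in Q -> v \in Q -> b \in Q -> btw a v b ->
     ((p v < p a)%R + (p b < p v)%R = (p b < p a)%R + q)%N.
Proof.
move=> inj H a v b aQ vQ bQ h; have [nva nvb nab] := btwW h.
have ne x y : x != y -> p x != p y by rewrite (inj_eq inj).
have nbv : b != v by rewrite eq_sym.
have nba : b != a by rewrite eq_sym.
move: h; rewrite (btwE o) => /or3P[] h; first exact: H.
- by apply: (orient_rot (ne _ _ nbv) (ne _ _ nba));
     apply: (orient_rot (ne _ _ nva) (ne _ _ nvb)); apply: H.
- by apply: (orient_rot (ne _ _ nbv) (ne _ _ nba)); apply: H.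
Qed.

(** Left of the chord the order from [j], right of it the order from [i], makes absolute values
    increase, so [orient_mid] reduces a triple to the sign at its middle vertex, which was taken
    from the colour of the piece. *)
Lemma chord_signs_oriented k t i j : i != j -> arc_increasing i j eps tau ->
  bicolored_subdivision k t -> facet_defining t i j ->
  oriented (phi i j (chord_signs t i j)) t.
Proof.
move=> nij ai bs fd Q; set p := phi i j _.
have nji : j != i by rewrite eq_sym.
have gp : in_general_position p by apply: chord_general_position.
have [pi pj po] := chord_fun_norm (chord_signs t i j) nij ai.
have [sd _ adj _] := bs; have [h1 h2 _] := subdivisionP sd.
have neg v : v != i -> v != j -> (p v < 0) = (v \in chord_signs t i j).
  by move=> *; apply: chord_fun_lt0.
have oth v : v != i -> v != j -> p v < - tau \/ tau < p v.
  move=> vi vj; rewrite /p chord_fun_other //; have [_ _ bd _ _] := ai.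
  by have /andP[? ?] := bd _ vi vj; case: ifP => _; [left|right]; lra.
have [/andP[t0 _] _ _ _ _] := ai.
have pi' : p i = - tau by rewrite /p chord_funl.
have pj' : p j = tau by rewrite /p chord_funr.
suff H : Q \in pieces t -> forall a v b, a \in Q -> v \in Q -> b \in Q -> btw a v b ->
     ((p v < p a)%R + (p b < p v)%R = (p b < p a)%R + (Q \in black t))%N.
  by move=> a v b QP; apply: H.
move=> QP.
have /existsP[L /and3P[LB /and4P[_ iL jL _] sL]] := fd.
have LP : L \in pieces t by rewrite in_setU LB.
case/orP: (facet_side nij bs fd QP) => sQ.
  apply: (@oriented_rank p Q _ j gp.1) => a v b aQ vQ bQ r.
  have vj : v != j by rewrite -rank_gt0; move: r; clear; lia.
  (* [orient_mid] fails when [i] is the middle vertex, as [i] and [j] have equal absolute value.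
     Then [a] is [j] and [Q] must be the black polygon [L] with edge [(i, j)], in agreement with
     [- tau < tau]. *)
  case: (eqVneq v i) => [vi|vi].
    have aj : a = j.
      apply: (@rank_inj _ j); move: (subsetP sQ _ aQ) r.
      by rewrite (in_cyc j) vi rankoo; clear; lia.
    have bj : b != j by rewrite -rank_gt0; move: r; clear; lia.
    have bi : b != i by apply/eqP => e; move: r; rewrite e vi ltnn andbF.
    have QL : Q = L.
      apply/eqP/negPn/negP => nQ; have d := h2 _ _ QP LP nQ.
      have ib : btw i b j.
        by have := subsetP sQ _ bQ; rewrite in_cyc_btw (negPf bi) (negPf bj).
      rewrite vi in vQ; rewrite aj in aQ.
      have := int_disjoint_side3 d vQ bQ aQ ib.
      case/or3P => /subsetP h.
      - by move: (h _ jL) ib; rewrite (in_cyc i) (btwE i) rankoo; clear; lia.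
      - by move: (h _ iL) ib; rewrite (in_cyc i) (btwE i) rankoo; clear; lia.
      - have [c3 _] := h1 _ LP.
        suff : (#|L| <= 2)%N by rewrite leqNgt c3.
        have <- : #|[set i; j]| = 2%N by rewrite cards2 nij.
        apply: subset_leq_card; apply/subsetP => u uL; rewrite in_set2.
        move: (h _ uL) (subsetP sL _ uL); rewrite !in_cyc_btw.
        case: (u == i) => //=; case: (u == j) => //=.
        by move=> h3 h4; rewrite (btw_asym h4) in h3.
    rewrite QL LB vi aj pi' pj'; case: (oth _ bi bj) => ?.
      have -> : - tau < tau by lra.
      have -> : p b < - tau by lra.
      by have -> : p b < tau by lra.
    have -> : - tau < tau by lra.
    have -> : (p b < - tau) = false by apply/negP; lra.
    by have -> : (p b < tau) = false by apply/negP; lra.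
  rewrite orient_mid; last exact: norm_increasing sQ aQ vQ bQ r vi.
  rewrite neg // (in_chord_signs nij bs QP sQ _ vi) //.
  exact: mid_mem r.
apply: (@oriented_rank p Q _ i gp.1) => a v b aQ vQ bQ r.
have vi : v != i by rewrite -rank_gt0; move: r; clear; lia.
(* The corresponding exception on the right: this piece shares the edge [(i, j)] with the black
   polygon [L], hence is white. *)
case: (eqVneq v j) => [vj|vj].
  have ae : a = i.
    apply: (@rank_inj _ i); move: (subsetP sQ _ aQ) r.
    by rewrite (in_cyc i) vj rankoo; clear; lia.
  have bi : b != i by rewrite -rank_gt0; move: r; clear; lia.
  have bj : b != j by apply/eqP => e; move: r; rewrite e vj ltnn andbF.
  have bl : btw j b i.
    by have := subsetP sQ _ bQ; rewrite in_cyc_btw (negPf bi) (negPf bj).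
  have nQ : L != Q.
    apply/eqP => e; move: bQ; rewrite -e => /(subsetP sL).
    by rewrite in_cyc_btw (negPf bi) (negPf bj) (btw_asym bl).
  have QW : Q \notin black t.
    rewrite vj in vQ; rewrite ae in aQ.
    have := adj _ _ LP QP nQ i j; rewrite LB /edge nij iL jL sL aQ vQ sQ orbT.
    by move=> /(_ isT isT); case: (Q \in black t).
  rewrite (negPf QW) vj ae pi' pj'; case: (oth _ bi bj) => ?.
    have -> : (tau < - tau) = false by apply/negP; lra.
    have -> : p b < - tau by lra.
    by have -> : p b < tau by lra.
  have -> : (tau < - tau) = false by apply/negP; lra.
  have -> : (p b < - tau) = false by apply/negP; lra.
  by have -> : (p b < tau) = false by apply/negP; lra.
rewrite orient_mid; last first.
  apply: (norm_increasing nji (arc_increasing_sym ai) pj pi _ sQ aQ vQ bQ r vj).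
  by move=> u uj ui; apply: po.
rewrite neg // chord_signs_sym (in_chord_signs nji bs QP sQ _ vj) //.
exact: mid_mem r.
Qed.

(** A vertex of the support is not last in the order from [j], so it is the middle vertex of some
    piece, whose orientation dictates its sign. The right side follows by exchanging [i] and [j]. *)
Lemma oriented_signs k t i j (p : 'I_n -> R) v : i != j -> arc_increasing i j eps tau ->
  bicolored_subdivision k t ->
  (forall Q, Q \in pieces t -> (Q \subset cyc i j) || (Q \subset cyc j i)) ->
  `|p i| = tau -> `|p j| = tau -> (forall u, u != i -> u != j -> `|p u| = eps u) ->
  oriented p t -> btw i v j -> v \in chord_support i j ->
  (p v < 0) = (v \in chord_signs t i j).
Proof.
move=> nij ai bs sides pi pj po ori vl; rewrite in_setC !in_setU !in_set1 !negb_or.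
move=> /andP[/andP[/andP[vi vj] _] vpj].
have [sd _ _ _] := bs.
have [Q QP vm] : exists2 Q, Q \in pieces t & v \in mid j Q.
  apply: mid_exists sd _; apply: (@mid_mem _ _ _ j _ (ord_pred j)); rewrite ?in_setT //.
  have := rank_pred_max j v; have := rank_neq j vpj; have := rank_gt0 j v.
  by rewrite rankoo vj; clear; lia.
have /midP[a [b [vQ aQ bQ r]]] := vm.
have sQ : Q \subset cyc i j.
  case/orP: (sides _ QP) => // /subsetP/(_ _ vQ).
  by rewrite in_cyc_btw (negPf vi) (negPf vj) (btw_asym vl).
have h : btw a v b by rewrite (btwE j) r.
have := ori _ _ _ _ QP aQ vQ bQ h.
rewrite orient_mid; last exact: norm_increasing sQ aQ vQ bQ r vi.
rewrite (in_chord_signs nij bs QP sQ vm vi) => /addnI.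
by case: (p v < 0); case: (Q \in black t).
Qed.

Lemma chord_signs_unique k t i j s : i != j -> arc_increasing i j eps tau ->
  bicolored_subdivision k t -> facet_defining t i j ->
  oriented (phi i j s) t -> s \subset chord_support i j -> s = chord_signs t i j.
Proof.
move=> nij ai bs fd ori /subsetP ss; have nji : j != i by rewrite eq_sym.
have [pi pj po] := chord_fun_norm s nij ai.
have sides := facet_side nij bs fd.
apply/setP => v; case: (boolP (v \in chord_support i j)) => vs; last first.
  by rewrite [RHS]in_set (negPf vs) /=; apply: contraNF vs; apply: ss.
have := vs; rewrite in_setC !in_setU !in_set1 !negb_or.
move=> /andP[/andP[/andP[vi vj] _] _].
rewrite -(chord_fun_lt0 s ai vi vj).
case/orP: (btwT nij vi vj) => vl; first exact: oriented_signs bs sides pi pj po ori vl vs.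
rewrite chord_signs_sym; apply: (oriented_signs nji (arc_increasing_sym ai) bs) => //.
- by move=> Q QP; rewrite orbC sides.
- by move=> u ui uj; apply: po.
- by rewrite chord_support_sym.
Qed.

(** The exchange affects only the tile equations of the chord itself, so the chord is compatible.
    Some piece then contains it with a vertex on its left, and orientations show that this piece is
    black and ends at the chord. *)
Lemma crossed_facet k t i j s : internal i j -> arc_increasing i j eps tau ->
  bicolored_subdivision k t -> tile k t (pt (phi i j s)) -> ~ tile k t (pt (phi j i s)) ->
  facet_defining t i j /\ area t i j = arcdes (phi i j s) i j.
Proof.
move=> int ai bs ht nt; have [nij ni nj] := internalP int.
have nji : j != i by rewrite eq_sym.
have [/andP[t0 _] _ bd _ _] := ai.
have gp := chord_general_position s nij ai.
have gp' := chord_general_position s nji (arc_increasing_sym ai).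
have [hs hA] := (tile_ptP n_gt1 k t gp).1 ht.
have [sd _ _ _] := bs.
have cij : compatible t i j.
  apply/negPn/negP => ncij; apply: nt; apply/(tile_ptP n_gt1 _ _ gp'); split.
    by rewrite -hs; apply: eq_bigr => v _; rewrite (chord_des _ _ int ai).
  move=> a b cab; rewrite -(chord_arcdes _ _ _ int ai) -hA //; congr addn; congr nat_of_bool.
  apply/esym; apply: chord_fun_lt => //; first by case/andP: cab.
    by apply: contra ncij => /andP[/eqP<- /eqP<-].
  by apply: contra ncij => /andP[/eqP<- /eqP<-]; rewrite compatible_sym.
have nS : i != ordS i by rewrite eq_sym -rank_gt0 rank_ordS.
have pi : phi i j s i = - tau by apply: chord_funl.
have pj : phi i j s j = tau by apply: chord_funr.
have oth v : v != i -> v != j -> phi i j s v < - tau \/ tau < phi i j s v.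
  move=> vi vj; rewrite chord_fun_other //.
  by have /andP[? ?] := bd _ vi vj; case: ifP => _; [left|right]; lra.
have ori := tile_oriented n_gt1 gp bs ht.
have lt1 : - tau < tau by lra.
have lt2 : (tau < - tau) = false by apply/negP; lra.
split; last first.
  by rewrite -hA // pi pj lt2 addn0.
have bi : btw i (ordS i) j by apply: rank_ge2; rewrite // eq_sym.
have [Q [v [QP iQ jQ vQ vl]]] := compatible_btw sd cij bi.
have [vi vj _] := btwW vl.
(* The value at [v] lies outside the interval from [- tau] to [tau], so the triple [i], [v], [j] has
   the opposite cyclic order. *)
have QB : Q \in black t.
  have := ori _ _ _ _ QP iQ vQ jQ vl; rewrite pi pj lt2.
  case: (oth _ vi vj) => ?.
    have -> : phi i j s v < - tau by lra.
    have -> : (tau < phi i j s v) = false by apply/negP; lra.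
    by case: (Q \in black t).
  have -> : (phi i j s v < - tau) = false by apply/negP; lra.
  have -> : tau < phi i j s v by lra.
  by case: (Q \in black t).
(* By the same comparison, a vertex of [Q] right of the chord would force [Q] to be white. *)
have sQ : Q \subset cyc i j.
  apply/subsetP => w wQ; rewrite in_cyc_btw.
  case: (eqVneq w i) => //= wi; case: (eqVneq w j) => //= wj.
  case/orP: (btwT nij wi wj) => // wr.
  have wr' : btw i j w by rewrite btw_rot.
  have := ori _ _ _ _ QP iQ jQ wQ wr'; rewrite pi pj lt2 QB.
  case: (oth _ wi wj) => ?.
    have -> : phi i j s w < tau by lra.
    by have -> : phi i j s w < - tau by lra.
  have -> : (phi i j s w < tau) = false by apply/negP; lra.
  by have -> : (phi i j s w < - tau) = false by apply/negP; lra.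
by apply/existsP; exists Q; rewrite QB /edge nij iQ jQ sQ.
Qed.

End Chord.

(** * The hypersimplex and the tiling *)

Section Hypersimplex.
Variables (R : realType) (n : nat).
Local Open Scope ring_scope.
Implicit Types (x y : 'rV[R]_n) (m : nat).

Lemma hypersimplex_convex m x y (l : R) : 0 <= l <= 1 ->
  hypersimplex m x -> hypersimplex m y -> hypersimplex m (l *: x + (1 - l) *: y).
Proof.
move=> /andP[l0 l1] [w [w0 w1 ->]] [w' [w0' w1' ->]].
exists (fun I => l * w I + (1 - l) * w' I); split.
- by move=> I; rewrite addr_ge0 // mulr_ge0 // subr_ge0.
- by rewrite big_split -!mulr_sumr w1 w1' /= !mulr1 addrC subrK.
- rewrite !scaler_sumr -big_split; apply: eq_bigr => I _ /=.
  by rewrite !scalerA -scalerDl.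
Qed.

Lemma hypersimplex_vertex m x : (forall v, x ord0 v = 0 \/ x ord0 v = 1) ->
  xsum [set: 'I_n] x = m%:R -> hypersimplex m x.
Proof.
move=> h01 hs; pose I := [set v | x ord0 v == 1].
have xI v : x ord0 v = (v \in I)%:R.
  rewrite in_set; case: (h01 v) => ->; last by rewrite eqxx.
  by rewrite eq_sym oner_eq0.
have cI : #|I| = m.
  apply/eqP; rewrite -(eqr_nat R) -hs -sum1_card natr_sum /xsum big_mkcond /=.
  rewrite [X in _ == X]big_mkcond /=; apply/eqP; apply: eq_bigr => v _.
  by rewrite in_setT xI; case: (v \in I).
exists (fun I' => (I' == I)%:R); split.
- by move=> I'; rewrite ler0n.
- rewrite (bigD1 I) ?cI //= eqxx big1 ?addr0 // => I' /andP[_ /negPf ->] //.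
- rewrite (bigD1 I) ?cI //= eqxx scale1r big1 ?addr0 => [|I' /andP[_ /negPf ->]].
    by apply/rowP => v; rewrite mxE xI.
  by rewrite scale0r.
Qed.

(* Moving along [e_u - e_w] in both directions until a coordinate becomes
   integral writes [x] as a convex combination of less fractional points. *)
Lemma hypersimplexP m x : (forall v, 0 <= x ord0 v <= 1) ->
  xsum [set: 'I_n] x = m%:R -> hypersimplex m x.
Proof.
pose frac x := [set v | (0 < x ord0 v < 1)].
have [d] := ubnP #|frac x|; elim: d x => // d IH x hd bd hs.
have nfr v : v \notin frac x -> x ord0 v = 0 \/ x ord0 v = 1.
  rewrite in_set negb_and -!leNgt => h; have /andP[? ?] := bd v.
  by case/orP: h => ?; [left|right]; lra.
case: (pickP (mem (frac x))) => [u uf|nof]; last first.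
  by apply: hypersimplex_vertex hs => v; apply: nfr; rewrite -[_ \in _]/(mem (frac x) v) nof.
(* A single fractional coordinate is impossible, as the sum of the coordinates is an integer. *)
case: (pickP (mem (frac x :\ u))) => [w|nof]; last first.
  have oth v : v != u -> x ord0 v = (x ord0 v == 1)%:R.
    move=> vu; have /nfr[->|->] : v \notin frac x.
      by have := nof v; rewrite /= in_setD1 vu /= => ->.
    - by rewrite eq_sym oner_eq0.
    - by rewrite eqxx.
  move: hs; rewrite /xsum (bigD1 u) ?in_setT //=.
  rewrite (eq_bigr (fun v => (x ord0 v == 1)%:R)); last by move=> v /andP[_ /oth].
  rewrite -natr_sum; set N := (\sum_(_ | _) _)%N => e.
  have := uf; rewrite /= in_set => /andP[u0 u1].
  have h1 : (N < m)%N by rewrite -(ltr_nat R); lra.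
  have h2 : (m < N.+1)%N by rewrite -(ltr_nat R) -natr1; lra.
  by move: h1 h2; clear; lia.
rewrite /= in_setD1 => /andP[wu wf]; rewrite /= in uf.
have uw : u != w by rewrite eq_sym.
have := uf; rewrite in_set => /andP[u0 u1]; have := wf; rewrite in_set => /andP[w0 w1].
pose y (e : R) : 'rV[R]_n := x + e *: (delta_mx 0 u - delta_mx 0 w).
have yu e : y e ord0 u = x ord0 u + e.
  by rewrite !mxE !eqxx /= (negPf uw) subr0 mulr1.
have yw e : y e ord0 w = x ord0 w - e.
  by rewrite !mxE !eqxx /= (negPf wu) sub0r mulrN1.
have yo e v : v != u -> v != w -> y e ord0 v = x ord0 v.
  by move=> vu vw; rewrite !mxE /= (negPf vu) (negPf vw) subrr mulr0 addr0.
have ys e : xsum [set: 'I_n] (y e) = m%:R.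
  rewrite -hs /xsum (bigD1 u) ?in_setT //= (bigD1 w) ?in_setT //= yu yw.
  rewrite [RHS](bigD1 u) ?in_setT //= [in RHS](bigD1 w) ?in_setT //=.
  rewrite (eq_bigr (fun v => x ord0 v)); first by ring.
  by move=> v /andP[/andP[_ ?] ?]; apply: yo.
have step e : 0 <= x ord0 u + e <= 1 -> 0 <= x ord0 w - e <= 1 ->
   ~~ ((0 < x ord0 u + e < 1) && (0 < x ord0 w - e < 1)) -> hypersimplex m (y e).
  move=> hu hw hn; apply: IH (ys e).
    apply: leq_trans (_ : #|frac (y e)| < #|frac x|)%N _; last by rewrite -ltnS.
    apply: proper_card; apply/properP; split.
      apply/subsetP => v; rewrite !in_set.
      case: (eqVneq v u) => [->|vu]; first by rewrite u0 u1.
      case: (eqVneq v w) => [->|vw]; first by rewrite w0 w1.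
      by rewrite yo.
    move: hn; rewrite negb_and => /orP[h|h].
      by exists u => //; rewrite in_set yu.
    by exists w => //; rewrite in_set yw.
  move=> v; case: (eqVneq v u) => [->|vu]; first by rewrite yu.
  by case: (eqVneq v w) => [->|vw]; rewrite ?yw ?yo.
(* The largest steps in the two directions that keep both coordinates in the unit interval; each
   makes one of them integral. *)
pose p := Num.min (1 - x ord0 u) (x ord0 w).
pose q := Num.min (x ord0 u) (1 - x ord0 w).
have p0 : 0 < p by rewrite lt_min subr_gt0 u1.
have q0 : 0 < q by rewrite lt_min subr_gt0 u0.
have hp : hypersimplex m (y p).
  have p1 : p <= 1 - x ord0 u by rewrite ge_min lexx.
  have p2 : p <= x ord0 w by rewrite ge_min lexx orbT.
  apply: step; try (apply/andP; split; lra).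
  apply/negP => /andP[/andP[_ h1] /andP[h2 _]].
  suff : p < p by rewrite ltxx.
  by rewrite {2}/p lt_min; apply/andP; split; lra.
have hq : hypersimplex m (y (- q)).
  have p1 : q <= 1 - x ord0 w by rewrite ge_min lexx orbT.
  have p2 : q <= x ord0 u by rewrite ge_min lexx.
  apply: step; try (apply/andP; split; lra).
  apply/negP => /andP[/andP[h1 _] /andP[_ h2]].
  suff : q < q by rewrite ltxx.
  by rewrite {2}/q lt_min; apply/andP; split; lra.
have pq : p + q != 0 by rewrite gt_eqF // addr_gt0.
have -> : x = (q / (p + q)) *: y p + (1 - q / (p + q)) *: y (- q).
  apply/rowP => v; rewrite !mxE; field.
  exact: pq.
apply: hypersimplex_convex hp hq.
have pq0 : 0 < p + q by apply: addr_gt0.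
apply/andP; split; first by rewrite divr_ge0 // ltW.
by rewrite ler_pdivrMr // mul1r lerDr ltW.
Qed.

End Hypersimplex.

(** * Counting tiles by sign patterns *)

Section Tiling.
Variables (R : realType) (n : nat).
Hypothesis n_gt1 : 1 < n.
Local Open Scope ring_scope.
Local Open Scope classical_set_scope.

Lemma xarc_continuous (a b : 'I_n) : continuous (xarc a b : 'rV[R]_n -> R).
Proof.
rewrite /xarc /xsum.
apply: continuous_big => [|v _]; last exact: coord_continuous.
exact: add_continuous.
Qed.

Lemma rel_interior_tile k (t : bicolored n) (x : 'rV[R]_n) : hyperplane k x ->
  (forall a b, compatible t a b -> (area t a b)%:R < xarc a b x < (area t a b)%:R + 1) ->
  rel_interior k (tile k t) x.
Proof.
move=> hx h; split=> //.
suff : \forall y \near x, forall a b, compatible t a b ->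
    (area t a b)%:R <= xarc a b y <= (area t a b)%:R + 1.
  move=> hn; apply: filterS hn => y hy hk; split=> //.
have key a b : \forall y \near x, compatible t a b ->
    (area t a b)%:R <= xarc a b y <= (area t a b)%:R + 1.
  case: (boolP (compatible t a b)) => [cab|_]; last by apply: filterE.
  have /andP[h1 h2] := h _ _ cab.
  have c := @xarc_continuous a b x.
  have n1 := cvgr_gt _ c _ h1; have n2 := cvgr_lt _ c _ h2.
  near=> y; move=> _; apply/andP; split; apply: ltW; near: y.
    exact: n1.
  exact: n2.
exact: (filter_forall _ (fun a => filter_forall _ (key a))).
Unshelve. all: by end_near. Qed.

Lemma pt_unit (phi : 'I_n -> R) v : in_general_position phi -> 0 <= pt phi ord0 v <= 1.
Proof.
move=> gp; rewrite mxE /des.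
have nv : v != ordS v by rewrite eq_sym -rank_gt0 rank_ordS.
by have := phi_diff gp nv; case: ifP => _ /andP[? ?]; apply/andP; split; rewrite /=; lra.
Qed.

(** In general position arc sums are not integers, so the tile inequalities hold strictly and the
    point is in the relative interior of any tile containing it. *)
Lemma tiling_unique k (S : {set bicolored n}) (phi : 'I_n -> R) t t' :
  positroid_tiling R k S -> in_general_position phi -> t \in S -> t' \in S ->
  tile k t (pt phi) -> tile k t' (pt phi) -> t = t'.
Proof.
move=> [_ dj _] gp tS tS' ht ht'; apply/eqP/negPn/negP => nt.
have int u : tile k u (pt phi) -> rel_interior k (tile k u) (pt phi).
  move=> hu; apply: rel_interior_tile; first by case: hu.
  move=> a b cab; have nab : a != b by case/andP: (cab).
  have [_ /(_ _ _ cab) e] := (tile_ptP n_gt1 k u gp).1 hu.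
  rewrite xarc_pt // -e natrD; have := phi_diff gp nab.
  by case: ifP => _ /andP[? ?]; apply/andP; split; rewrite /=; lra.
have : (rel_interior k (tile k t) `&` rel_interior k (tile k t')) (pt phi).
  by split; apply: int.
by rewrite dj.
Qed.

Lemma tiling_exists k (S : {set bicolored n}) (phi : 'I_n -> R) :
  positroid_tiling R k S -> in_general_position phi -> (\sum_v des phi v = k.+1)%N ->
  exists2 t, t \in S & tile k t (pt phi).
Proof.
move=> [_ _ cover] gp hs.
have : hypersimplex k.+1 (pt phi).
  by apply: hypersimplexP => [v|]; [apply: pt_unit | rewrite xsum_pt // hs].
by rewrite -cover => -[t /= tS ht]; exists t.
Qed.

(** The patterns whose two points lie on either side of the wall [x_[i, j-1] = c] and in no common
    tile: the arc sum is [c + 2 tau] at one point and [c - 2 tau] at the other. *)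
Definition crossed_signs k (S : {set bicolored n}) (eps : 'I_n -> R) tau c i j :=
  [set s : {set 'I_n} | [&& s \subset chord_support i j,
    (\sum_v des (chord_fun eps tau i j s) v)%N == k.+1,
    arcdes (chord_fun eps tau i j s) i j == c &
    ~~ [exists t in S, `[< tile k t (pt (chord_fun eps tau i j s)) >]
                    && `[< tile k t (pt (chord_fun eps tau j i s)) >]]]]%SET.

Definition facet_tiles (S : {set bicolored n}) c i j : {set bicolored n} :=
  [set t in S | facet_defining t i j && (area t i j == c)]%SET.

(** The bijection sends a tile to its [chord_signs]. It is injective because tiles with equal signs
    contain the same point, and surjective by [crossed_facet] and the uniqueness of signs. *)
Lemma card_facet_tiles k (S : {set bicolored n}) eps tau c i j :
  positroid_tiling R k S -> internal i j -> arc_increasing i j eps tau ->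
  #|facet_tiles S c i j| = #|crossed_signs k S eps tau c i j|.
Proof.
move=> tl int ai; have [nij _ _] := internalP int.
have nji : j != i by rewrite eq_sym.
have [bsS _ _] := tl; have [/andP[t0 _] _ _ _ _] := ai.
have gp s := chord_general_position s nij ai.
have gp' s := chord_general_position s nji (arc_increasing_sym ai).
have inT t : t \in S -> facet_defining t i j ->
    tile k t (pt (chord_fun eps tau i j (chord_signs t i j))).
  move=> tS fd; apply: oriented_tile (compatible_facet fd) _ => //; first exact: bsS.
  by apply: chord_signs_oriented => //; apply: bsS.
rewrite -(@card_in_imset _ _ (fun t => chord_signs t i j)); last first.
  move=> t t'; rewrite 2!in_set => /and3P[tS fd _] /and3P[tS' fd' _] e.
  apply: (tiling_unique tl (gp _) tS tS' (inT _ tS fd)).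
  by rewrite e; apply: inT.
apply: eq_card => s; rewrite [RHS]in_set; apply/imsetP/and4P.
  move=> [t]; rewrite in_set => /and3P[tS fd /eqP ac] ->.
  set p := chord_fun eps tau i j _.
  have ht : tile k t (pt p) by apply: inT.
  have [hs hA] := (tile_ptP n_gt1 k t (gp _)).1 ht.
  have cij := compatible_facet fd.
  have pij : (p j < p i) = false.
    by rewrite /p chord_funl chord_funr //; apply/negP; lra.
  have ad : arcdes p i j = c by rewrite -hA // pij addn0.
  split; [| by rewrite hs | by rewrite ad|].
    by apply/fintype.subsetP => v; rewrite in_set => /andP[].
  apply/negP => /existsP[t' /and3P[tS' /asboolP h1 /asboolP h2]].
  rewrite (tiling_unique tl (gp _) tS' tS h1 ht) in h2.
  (* Across the wall the chord is a descent, so the tile equation would read [c + 1 = c]. *)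
  have [_ /(_ _ _ cij)] := (tile_ptP n_gt1 k t (gp' _)).1 h2.
  rewrite -(chord_arcdes n_gt1 _ _ _ int ai) ad ac chord_funl chord_funr //.
  have -> : - tau < tau by lra.
  by clear; lia.
move=> [ss /eqP hs /eqP ad nex].
have [t tS ht] := tiling_exists tl (gp s) hs.
have nt : ~ tile k t (pt (chord_fun eps tau j i s)).
  move=> ht'; case/negP: nex; apply/existsP; exists t; rewrite tS /=.
  by apply/andP; split; apply/asboolP.
have bs := bsS _ tS.
have [fd ar] := crossed_facet n_gt1 int ai bs ht nt.
exists t; first by rewrite in_set tS fd ar ad eqxx.
by apply: (chord_signs_unique nij ai bs fd _ ss); apply: tile_oriented bs ht.
Qed.

(** Both sides count the same patterns: [crossed_signs] is unchanged when [i] and [j] are exchanged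
    and [c] becomes [k + 1 - c]. *)
Lemma card_facet_tiles_rev k (S : {set bicolored n}) c i j :
  positroid_tiling R k S -> internal i j -> (c <= k.+1)%N ->
  #|facet_tiles S c i j| = #|facet_tiles S (k.+1 - c)%N j i|.
Proof.
move=> tl int ck; have [nij ni nj] := internalP int.
have nji : j != i by rewrite eq_sym.
have int' : internal j i.
  by move: int; rewrite /internal /edge !in_setT eq_sym orbC.
(* Away from [i] the ranks run from 1 to [n - 1], so [eps] lies between [1/(2n)] and [1/2]; [tau] is
   half that lower bound. *)
pose eps v : R := (rank i v)%:R / (2 * n)%:R.
pose tau : R := (4 * n)%:R^-1.
have n0 : (0 < n)%N by apply: leq_ltn_trans n_gt1.
have n0' : 0 < n%:R :> R by rewrite ltr0n.
have epsE u v : (eps u < eps v) = (rank i u < rank i v)%N.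
  by rewrite ltr_pM2r ?ltr_nat // invr_gt0 ltr0n muln_gt0.
have ai : arc_increasing i j eps tau.
  split.
  - rewrite invr_gt0 ltr0n muln_gt0 n0 /=.
    rewrite div1r ltf_pV2 ?posrE ?ltr0n ?muln_gt0 //.
    by rewrite (ltr_nat _ 2); move: n0; clear; lia.
  - move=> u v e; apply: (@rank_inj _ i).
    by case: (ltngtP (rank i u) (rank i v)) => //; rewrite -epsE e ltxx.
  - move=> v vi _; apply/andP; split.
      rewrite /tau /eps ltr_pdivlMr ?ltr0n ?muln_gt0 ?n0 //.
      have -> : (4 * n)%:R^-1 * (2 * n)%:R = 1/2 :> R.
        by rewrite !natrM; field; rewrite gt_eqF.
      have : 1 <= (rank i v)%:R :> R by rewrite ler1n rank_gt0.
      by move=> ?; lra.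
    rewrite /eps ltr_pdivrMr ?ltr0n ?muln_gt0 ?n0 //.
    have -> : 1/2 * (2 * n)%:R = n%:R :> R by rewrite natrM; field.
    by rewrite ltr_nat rank_lt.
  - by move=> a b h _; rewrite epsE; move: h; rewrite /btw; clear; lia.
  - move=> a b h h'; rewrite epsE; have := rank_gt0 i j; rewrite nji.
    by move: h h'; rewrite !(btwE i) rankoo; clear; lia.
rewrite (card_facet_tiles _ tl int ai).
rewrite (card_facet_tiles _ tl int' (arc_increasing_sym ai)).
apply: eq_card => s; rewrite !in_set chord_support_sym; congr andb.
have -> : (\sum_v des (chord_fun eps tau j i s) v =
          \sum_v des (chord_fun eps tau i j s) v)%N.
  by apply: eq_bigr => v _; rewrite (chord_des n_gt1 _ _ int ai).
case: eqP => //= hs; congr andb.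
  have := arcdes_rev (chord_fun eps tau i j s) nij; rewrite hs.
  rewrite -(chord_arcdes n_gt1 _ _ _ int ai); move: ck; clear.
  by set x := arcdes _ _ _; set y := arcdes _ _ _; lia.
by congr negb; apply: eq_existsb => t; rewrite andbCA andbC andbA andbC -andbA.
Qed.

End Tiling.

(** * Facet inequalities as half-spaces *)

Section HalfSpaces.
Variables (R : realType) (n : nat).
Local Open Scope ring_scope.
Local Open Scope classical_set_scope.

Lemma half_space_eq k (A A' : {set 'I_n}) (c c' : R) :
  A != finset.set0 -> A != [set: 'I_n]%SET ->
  hyperplane k `&` [set x : 'rV[R]_n | c <= xsum A x]
    = hyperplane k `&` [set x | c' <= xsum A' x] ->
  A = A' /\ c = c'.
Proof.
move=> /set0Pn[u0 u0A]; rewrite -finset.subTset => /subsetPn[w0 _ w0A] e.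
have xD (B : {set 'I_n}) (x y : 'rV[R]_n) : xsum B (x + y) = xsum B x + xsum B y.
  by rewrite /xsum -big_split; apply: eq_bigr => v _; rewrite mxE.
have xd (B : {set 'I_n}) u (l : R) : xsum B (l *: delta_mx 0 u) = l * (u \in B)%:R.
  rewrite /xsum; case: (boolP (u \in B)) => uB.
    rewrite (bigD1 u) //= big1 ?mxE ?eqxx ?addr0 // => v /andP[_ /negPf vu].
    by rewrite !mxE vu andbF mulr0.
  rewrite big1 ?mulr0 // => v vB; rewrite !mxE.
  have -> : v == u = false by apply: contraNF uB => /eqP <-.
  by rewrite andbF mulr0.
(* Test points of the hyperplane supported on [u] in [A] and [w] outside it: the sum over [A] is the
   free parameter [l], which must also be the sum over [A']. *)
pose x u w (l : R) : 'rV[R]_n := l *: delta_mx 0 u + (k.+1%:R - l) *: delta_mx 0 w.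
have hx u w l : hyperplane k (x u w l).
  by rewrite /hyperplane /= xD !xd !in_setT !mulr1 addrC subrK.
have iff u w l : (c <= l * (u \in A)%:R + (k.+1%:R - l) * (w \in A)%:R) =
                 (c' <= l * (u \in A')%:R + (k.+1%:R - l) * (w \in A')%:R).
  rewrite -!xd -!xD -/(x u w l); apply/idP/idP => h.
    have : (hyperplane k `&` [set x | c' <= xsum A' x]) (x u w l) by rewrite -e; split.
    by case.
  have : (hyperplane k `&` [set x | c <= xsum A x]) (x u w l) by rewrite e; split.
  by case.
have mem u w : u \in A -> w \notin A -> u \in A' /\ w \notin A'.
  move=> uA wA; have h l := iff u w l.
  move: h; rewrite uA (negPf wA).
  case: (u \in A'); case: (w \in A') => //= h; exfalso.
  - have := h c; have := h (c - 1); rewrite !mulr1 !mulr0 !addr0 lexx.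
    have -> : (c <= c - 1) = false by apply/negP; lra.
    by move=> h1 h2; move: h1; rewrite addrC subrK => h1; move: h2; rewrite addrC subrK -h1.
  - pose l := Num.max c (k.+1%:R - c' + 1).
    have l1 : c <= l by rewrite le_max lexx.
    have l2 : k.+1%:R - c' + 1 <= l by rewrite le_max lexx orbT.
    have l3 : c' <= k.+1%:R - l.
      by have := h l; rewrite !mulr1 !mulr0 addr0 add0r l1 => <-.
    by move: l2 l3; clear; lra.
  - have := h c; have := h (c - 1); rewrite !mulr1 !mulr0 !addr0 lexx.
    have -> : (c <= c - 1) = false by apply/negP; lra.
    by move=> <-.
have AA : A = A'.
  apply/setP => v; case: (boolP (v \in A)) => vA.
    by have [-> _] := mem _ _ vA w0A.
  by have [_ /negPf->] := mem _ _ u0A vA.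
split=> //.
have := iff u0 w0 c; have := iff u0 w0 c'; rewrite -AA u0A (negPf w0A).
rewrite !mulr1 !mulr0 !addr0 !lexx => h1 /esym h2.
by apply/eqP; rewrite eq_le h1 h2.
Qed.

Lemma arc_inj (a b i j : 'I_n) : a != b -> i != j ->
  cyc a (ord_pred b) = cyc i (ord_pred j) -> a = i /\ b = j.
Proof.
move=> nab nij /setP e.
have e' v : (rank a v < rank a b)%N = (rank i v < rank i j)%N.
  by rewrite -!in_arc // e.
have rai : (rank a i < rank a b)%N by rewrite e' rankoo rank_gt0 eq_sym.
have ai : a = i.
  apply/eqP/negPn/negP => nai; move: (e' (ord_pred i)) (rank_pred_max i j) rai.
  by rewrite rank_pred //; clear; lia.
split=> //; apply: (@rank_inj _ i); move: (e' b) (e' j); rewrite ai; clear; lia.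
Qed.

(** Equal half-spaces have equal arcs and bounds. As [c] is positive, an inequality [x_a >= 0] from
    a white polygon cannot occur. *)
Lemma facet_inequalityP k c (t : bicolored n) (i j : 'I_n) : (0 < c)%N -> i != j ->
  facet_inequality k t (hyperplane k `&` [set x : 'rV[R]_n | c%:R <= xarc i j x])
  <-> facet_defining t i j /\ area t i j = c.
Proof.
move=> c0 nij.
have ne : cyc i (ord_pred j) != finset.set0.
  by apply/set0Pn; exists i; rewrite in_arc // rankoo rank_gt0 eq_sym.
have nT : cyc i (ord_pred j) != [set: 'I_n]%SET.
  apply/eqP => /setP/(_ j); rewrite in_setT in_arc //; clear; lia.
split=> [[[Q [a [_ _ e]]]|[a [b [fd e]]]]|[fd ac]].
- have e1 : hyperplane k `&` [set x : 'rV[R]_n | c%:R <= xarc i j x]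
      = hyperplane k `&` [set x | 0 <= xsum [set a]%SET x].
    rewrite e; congr (_ `&` _).
    by apply/seteqP; split=> x /=; rewrite /xsum big_set1.
  have [_ /eqP] := half_space_eq ne nT e1.
  by rewrite pnatr_eq0; move: c0; clear; lia.
- have nab : a != b by case/andP: (compatible_facet fd).
  have [ea /eqP] := half_space_eq ne nT e; rewrite eqr_nat => /eqP ->.
  by have [-> ->] := arc_inj nij nab ea.
- by right; exists i, j; split=> //; rewrite ac.
Qed.

End HalfSpaces.

Local Open Scope ring_scope.
Local Open Scope classical_set_scope.

Theorem theorem6p11 (R : realType) (n k c : nat) (S : {set bicolored n})
    (i j : 'I_n) :
  (3 <= n)%N -> positroid_tiling R k S -> (1 <= c <= k)%N -> internal i j ->
  #|[pred s in S | `[< facet_inequality k s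
       (hyperplane k `&` [set x : 'rV[R]_n | xarc i j x >= c%:R]) >]]|
  = #|[pred s in S | `[< facet_inequality k s
       (hyperplane k `&` [set x : 'rV[R]_n | xarc i j x <= c%:R]) >]]|
  /\
  #|[pred s in S | facet_defining s i j && (area s i j == c)]|
  = #|[pred s in S | facet_defining s j i && (area s i j == c.-1)]|.
Proof.
move=> n3 tl /andP[c1 ck] int.
have n_gt1 : (1 < n)%N by apply: ltn_trans n3.
have [nij _ _] := internalP int; have nji : j != i by rewrite eq_sym.
have E := card_facet_tiles_rev n_gt1 tl int (leqW ck).
have cnt a b d (P : pred (bicolored n)) :
    (forall s, s \in S -> P s = facet_defining s a b && (area s a b == d)) ->
    #|[pred s in S | P s]| = #|facet_tiles S d a b|.
  move=> h; apply: eq_card => s; rewrite in_set inE /=.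
  by case sS : (s \in S) => //=; apply: h.
have ineq a b d : a != b -> (0 < d)%N -> forall s,
    `[< facet_inequality k s (hyperplane k `&` [set x : 'rV[R]_n | d%:R <= xarc a b x]) >]
    = facet_defining s a b && (area s a b == d).
  move=> nab d0 s; have [P1 P2] := facet_inequalityP R k s d0 nab.
  apply/asboolP/andP => [/P1[fd ->]//|[fd /eqP ar]].
  exact: P2.
(* The two complementary arc sums add up to [k + 1], so an upper bound for one is a lower bound for
   the other. *)
have rev : hyperplane k `&` [set x : 'rV[R]_n | xarc i j x <= c%:R] =
    hyperplane k `&` [set x | (k.+1 - c)%:R <= xarc j i x].
  have sum_arcs (x : 'rV[R]_n) : hyperplane k x -> xarc i j x + xarc j i x = k.+1%:R.
    move=> <-; rewrite /xarc /xsum sum_arc_compl //.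
    by apply: eq_bigl => v; rewrite in_setT.
  have cR : (k.+1 - c)%:R = k.+1%:R - c%:R :> R by rewrite natrB // leqW.
  by apply/seteqP; split=> x [hx h]; split=> //; move: h (sum_arcs _ hx);
     rewrite /= cR; clear; lra.
have d0 : (0 < k.+1 - c)%N by rewrite subn_gt0.
split.
  rewrite rev (cnt i j c); last by move=> s _; apply: ineq.
  by rewrite E; apply/esym; apply: cnt => s _; apply: ineq.
rewrite (cnt i j c) // E; apply/esym; apply: cnt => s sS.
case fd : (facet_defining s j i) => //=.
(* By [area_rev], area [k + 1 - c] for [j -> i] means area [c - 1] for [i -> j]. *)
have [bs _ _] := tl; have := area_rev (bs _ sS) (compatible_facet fd).
by move: c1 ck; clear; lia.
Qed.
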